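(* Let $C$ be a coalgebra over a field $\Bbbk$ and suppose that the Hopf algebra $H$ over $\Bbbk$ is finite dimensional. Then the following statements are equivalent: 1. $C$ is a left partial $H$-comodule coalgebra; 2. $C^*$ is a right partial $H$-comodule algebra; 3. $C$ is a right partial $H^*$-module coalgebra; 4. $C^*$ is a left partial $H^*$-module algebra. The relations between the correspondent actions and coactions are given in the following way, for any $c\in C$, $\alpha\in C^*$ and $f\in H^*$: $$\alpha(c^{\overline{0}})\,c^{-\overline{1}}=\alpha^{\overline{0}}(c)\,\alpha^{+\overline{1}},$$ $$(f\rightharpoonup\alpha)(c)=\alpha(c\leftharpoonup f),$$ $$c\leftharpoonup f=f(c^{-\overline{1}})\,c^{\overline{0}},$$ $$f\rightharpoonup\alpha=\alpha^{\overline{0}}f(\alpha^{+\overline{1}}),$$ where $\lambda'\colon c\mapsto c^{-\overline{1}}\otimes c^{\overline{0}}\in H\otimes C$ and $\rho'\colon\alpha\mapsto\alpha^{\overline{0}}\otimes\alpha^{+\overline{1}}\in C^*\otimes H$ are the partial coactions on $C$ and $C^*$, respectively, and $\leftharpoonup\colon C\otimes H^*\to C$ and $\rightharpoonup\colon H^*\otimes C^*\to C^*$ are the partial actions on $C$ and $C^*$, respectively.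
   Context: All objects are over a field $\Bbbk$; $\Delta(c)=c_1\otimes c_2$ and $\varepsilon$ denotes the counit; $C^*$ is an algebra under convolution; $H^*$ is the dual Hopf algebra. $\tau_{V,W}\colon V\otimes W\to W\otimes V$ is the flip and $m_H$ the multiplication of $H$. Left partial $H$-comodule coalgebra $(C,\lambda')$: $\lambda'\colon C\to H\otimes C$ linear such that for all $c\in C$, (1) $(\varepsilon_H\otimes I)\lambda'(c)=c$; (2) $(I\otimes\Delta_C)\lambda'(c)=(m_H\otimes I\otimes I)(I\otimes\tau_{C,H}\otimes I)(\lambda'\otimes\lambda')\Delta_C(c)$; (3) $(I\otimes\lambda')\lambda'(c)=(m_H\otimes I\otimes I)\{\nabla\otimes[(\Delta_H\otimes I)\lambda']\}\Delta_C(c)$, where $\nabla(c)=(I\otimes\varepsilon_C)\lambda'(c)$. Right partial $H$-comodule algebra $(A,\rho')$: $A$ a unital algebra, $\rho'\colon A\to A\otimes H$ linear such that for all $a,b\in A$, $(I\otimes\varepsilon_H)\rho'(a)=a$; $\rho'(ab)=\rho'(a)\rho'(b)$; $(\rho'\otimes I)\rho'(a)=(\rho'(1_A)\otimes 1_H)\,(I\otimes\Delta_H)\rho'(a)$. For a Hopf algebra $K$: a right partial $K$-module coalgebra $(C,\leftharpoonup)$ is a coalgebra $C$ with a linear map $\leftharpoonup\colon C\otimes K\to C$ satisfying $c\leftharpoonup 1_K=c$, $\Delta(c\leftharpoonup h)=c_1\leftharpoonup h_1\otimes c_2\leftharpoonup h_2$, $(c\leftharpoonup h)\leftharpoonup g=\varepsilon(c_1\leftharpoonup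 h_1)(c_2\leftharpoonup h_2g)$. A left partial $K$-module algebra $(A,\rightharpoonup)$ is a unital algebra $A$ with a linear map $\rightharpoonup\colon K\otimes A\to A$ satisfying $1_K\rightharpoonup a=a$, $h\rightharpoonup(ab)=(h_1\rightharpoonup a)(h_2\rightharpoonup b)$, $h\rightharpoonup(k\rightharpoonup a)=(h_1\rightharpoonup 1_A)(h_2k\rightharpoonup a)$.
   Formalization: For infinite-dimensional C, a partial (co)action on C^* need not come from C; so passing from statements 2 and 4 to 1 and 3 is proved for (co)actions already linked by the stated relations, and existence of the linked structure on C from one on C^* only when C is finite dimensional. *)

(* Defs.v *)
From HB Require Import structures.
From mathcomp Require Import all_boot all_algebra.
From mathcomp Require Import boolp functions.
Set Implicit Arguments.
Unset Strict Implicit.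
Unset Printing Implicit Defensive.
Import GRing.Theory.
Local Open Scope ring_scope.
Local Open Scope quotient_scope.

Reserved Notation "V ⊗ W" (at level 38, left associativity).
Reserved Notation "x ∗ y" (at level 40, left associativity).
Reserved Notation "v ⊗ₜ w" (at level 38, left associativity).

(* The tensor product of two vector spaces (possibly of infinite dimension):  *)
(* finite formal sums of pairs, modulo the congruence [tens_rel] generated by *)
(* commutativity of the formal sum and bilinearity.                           *)
Section TensorDef.
Variables (k : fieldType) (V W : lmodType k).

Inductive tens_rel : seq (V * W) -> seq (V * W) -> Prop :=
| tens_rel_refl s : tens_rel s s
| tens_rel_sym s t : tens_rel s t -> tens_rel t s
| tens_rel_trans s t u : tens_rel s t -> tens_rel t u -> tens_rel s u
| tens_rel_cat s s' t t' :
    tens_rel s s' -> tens_rel t t' -> tens_rel (s ++ t) (s' ++ t')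
| tens_rel_catC s t : tens_rel (s ++ t) (t ++ s)
| tens_rel_0 w : tens_rel [:: (0, w)] [::]
| tens_rel_addl v v' w : tens_rel [:: (v + v', w)] [:: (v, w); (v', w)]
| tens_rel_addr v w w' : tens_rel [:: (v, w + w')] [:: (v, w); (v, w')]
| tens_rel_scale a v w : tens_rel [:: (a *: v, w)] [:: (v, a *: w)].

Definition tens_relb (s t : seq (V * W)) : bool := `[< tens_rel s t >].

Lemma tens_relb_refl : reflexive tens_relb.
Proof. by move=> s; apply/asboolP; exact: tens_rel_refl. Qed.
Lemma tens_relb_sym : symmetric tens_relb.
Proof. by move=> s t; apply/asboolP/asboolP; exact: tens_rel_sym. Qed.
Lemma tens_relb_trans : transitive tens_relb.
Proof.
move=> t s u /asboolP st /asboolP tu; apply/asboolP.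
exact: tens_rel_trans st tu.
Qed.

Canonical tens_equiv :=
  EquivRel tens_relb tens_relb_refl tens_relb_sym tens_relb_trans.

Definition tensor := {eq_quot tens_equiv}.
HB.instance Definition _ := Choice.on tensor.
HB.instance Definition _ := EqQuotient.on tensor.

Definition tens (v : V) (w : W) : tensor := \pi_tensor [:: (v, w)].

Lemma tens_eqP (s t : seq (V * W)) :
  reflect (\pi_tensor s = \pi_tensor t) `[< tens_rel s t >].
Proof. by apply: (iffP idP) => [h|/eqmodP //]; apply/eqmodP. Qed.

Let scale_seq (a : k) (s : seq (V * W)) := [seq (a *: p.1, p.2) | p <- s].

Lemma tens_rel_map a s t :
  tens_rel s t -> tens_rel (scale_seq a s) (scale_seq a t).
Proof.
elim=> {s t} [s|s t _|s t u _ + _|s s' t t' _ + _|s t|w|v v' w|v w w'|b v w] /=.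
- exact: tens_rel_refl.
- exact: tens_rel_sym.
- exact: tens_rel_trans.
- by rewrite /scale_seq !map_cat; exact: tens_rel_cat.
- by rewrite /scale_seq !map_cat; exact: tens_rel_catC.
- by rewrite scaler0; exact: tens_rel_0.
- by rewrite scalerDr; exact: tens_rel_addl.
- exact: tens_rel_addr.
- by rewrite scalerA mulrC -scalerA; exact: tens_rel_scale.
Qed.

Definition tens_add (x y : tensor) : tensor := \pi_tensor (repr x ++ repr y).
Definition tens_zero : tensor := \pi_tensor [::].
Definition tens_scale (a : k) (x : tensor) : tensor :=
  \pi_tensor (scale_seq a (repr x)).
Definition tens_opp (x : tensor) : tensor := tens_scale (-1) x.

Lemma tens_rel_repr s : tens_rel (repr (\pi_tensor s)) s.
Proof. by apply/asboolP; apply/tens_eqP; rewrite reprK. Qed.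

Lemma tens_addE s t :
  tens_add (\pi_tensor s) (\pi_tensor t) = \pi_tensor (s ++ t).
Proof.
by apply/tens_eqP/asboolP; apply: tens_rel_cat; exact: tens_rel_repr.
Qed.

Lemma tens_scaleE a s :
  tens_scale a (\pi_tensor s) = \pi_tensor (scale_seq a s).
Proof.
by apply/tens_eqP/asboolP; apply: tens_rel_map; exact: tens_rel_repr.
Qed.

Lemma tens_quotP (P : tensor -> Prop) :
  (forall s, P (\pi_tensor s)) -> forall x, P x.
Proof. by move=> h x; rewrite -(reprK x). Qed.

Lemma tens_addC : commutative tens_add.
Proof.
elim/tens_quotP=> s; elim/tens_quotP=> t; rewrite !tens_addE.
by apply/tens_eqP/asboolP; exact: tens_rel_catC.
Qed.
Lemma tens_addA : associative tens_add.
Proof.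
elim/tens_quotP=> s; elim/tens_quotP=> t; elim/tens_quotP=> u.
by rewrite !tens_addE catA.
Qed.
Lemma tens_add0 : left_id tens_zero tens_add.
Proof. by elim/tens_quotP=> s; rewrite tens_addE. Qed.

Lemma tens_scaleDl x a b :
  tens_scale (a + b) x = tens_add (tens_scale a x) (tens_scale b x).
Proof.
elim/tens_quotP: x => s; rewrite !tens_scaleE tens_addE.
apply/tens_eqP/asboolP.
elim: s => [|[v w] s IHs] /=; first exact: tens_rel_refl.
rewrite -cat1s scalerDl.
apply: (@tens_rel_trans _
  ([:: (a *: v, w); (b *: v, w)] ++ (scale_seq a s ++ scale_seq b s))).
  by apply: tens_rel_cat => //; exact: tens_rel_addl.
set sa := scale_seq a s; set sb := scale_seq b s; set p := (a *: v, w); set q := (b *: v, w).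
change (tens_rel ([:: p] ++ (([:: q] ++ sa) ++ sb)) ([:: p] ++ (sa ++ [:: q] ++ sb))).
apply: tens_rel_cat; first exact: tens_rel_refl.
by rewrite catA; apply: tens_rel_cat; [exact: tens_rel_catC | exact: tens_rel_refl].
Qed.

Lemma tens_scale0 x : tens_scale 0 x = tens_zero.
Proof.
elim/tens_quotP: x => s; rewrite tens_scaleE.
apply/tens_eqP/asboolP; elim: s => [|[v w] s IHs] /=.
  exact: tens_rel_refl.
rewrite scale0r -cat1s -[X in tens_rel _ X]cat0s.
by apply: tens_rel_cat => //; exact: tens_rel_0.
Qed.

Lemma tens_scale1 : left_id 1 tens_scale.
Proof.
elim/tens_quotP=> s; rewrite tens_scaleE /scale_seq.
by under eq_map do rewrite scale1r -surjective_pairing; rewrite map_id.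
Qed.

Lemma tens_addN : left_inverse tens_zero tens_opp tens_add.
Proof.
move=> x; rewrite /tens_opp -[X in tens_add _ X]tens_scale1.
by rewrite -tens_scaleDl addNr tens_scale0.
Qed.

HB.instance Definition _ :=
  GRing.isZmodule.Build tensor tens_addA tens_addC tens_add0 tens_addN.

Lemma tens_scaleA a b x : tens_scale a (tens_scale b x) = tens_scale (a * b) x.
Proof.
elim/tens_quotP: x => s; rewrite !tens_scaleE /scale_seq -map_comp.
by congr \pi_tensor; apply: eq_map => p /=; rewrite scalerA.
Qed.

Lemma tens_scaleDr : right_distributive tens_scale +%R.
Proof.
move=> a; elim/tens_quotP=> s; elim/tens_quotP=> t.
rewrite -[LHS]/(tens_scale a (tens_add _ _)) tens_addE !tens_scaleE.
by rewrite -[RHS]/(tens_add _ _) tens_addE /scale_seq map_cat.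
Qed.

HB.instance Definition _ := GRing.Zmodule_isLmodule.Build k tensor
  tens_scaleA tens_scale1 tens_scaleDr (fun x => tens_scaleDl x).

Lemma tens_bilinear : bilinear_for *:%R *:%R tens.
Proof.
split=> [w|v] a x y; rewrite -[RHS]/(tens_add (tens_scale _ _) _) /=.
  rewrite /tens tens_scaleE tens_addE.
  by apply/tens_eqP/asboolP; exact: tens_rel_addl.
rewrite /tens tens_scaleE tens_addE.
apply/tens_eqP/asboolP; apply: tens_rel_trans (tens_rel_addr _ _ _) _.
apply: (@tens_rel_cat [:: _] [:: _]); last exact: tens_rel_refl.
by apply: tens_rel_sym; exact: tens_rel_scale.
Qed.
HB.instance Definition _ :=
  bilinear_isBilinear.Build k V W tensor _ _ tens tens_bilinear.

Lemma tens_piE s : \pi_tensor s = \sum_(p <- s) tens p.1 p.2.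
Proof.
elim: s => [|[v w] s IHs]; first by rewrite big_nil.
by rewrite big_cons -IHs -[RHS]/(tens_add _ _) tens_addE.
Qed.

Lemma tens_ind (P : tensor -> Prop) :
  P 0 -> (forall v w x, P x -> P (tens v w + x)) -> forall x, P x.
Proof.
move=> P0 PD; elim/tens_quotP=> s; rewrite tens_piE.
by elim: s => [|p s IHs]; rewrite ?big_nil// big_cons; exact: PD.
Qed.

End TensorDef.

Notation "V ⊗ W" := (tensor V W).
Notation "v ⊗ₜ w" := (tens v w) : ring_scope.

(* The map V ⊗ W -> U induced by f : V -> W -> U. It is meaningful only when  *)
(* f is bilinear.                                                             *)
Section TensorLift.
Variables (k : fieldType) (V W U : lmodType k).
Implicit Type f : V -> W -> U.

Definition tens_lift f (x : V ⊗ W) : U := \sum_(p <- repr x) f p.1 p.2.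

Section Theory.
Variable f : V -> W -> U.
Hypothesis fB : bilinear_for *:%R *:%R f.

Let f0 w : f 0 w = 0.
Proof. by have /= := fB.1 w (-1) 0 0; rewrite scaler0 addr0 scaleN1r addNr. Qed.
Let fDl v v' w : f (v + v') w = f v w + f v' w.
Proof. by have /= := fB.1 w 1 v v'; rewrite !scale1r. Qed.
Let fDr v w w' : f v (w + w') = f v w + f v w'.
Proof. by have /= := fB.2 v 1 w w'; rewrite !scale1r. Qed.
Let fZl a v w : f (a *: v) w = a *: f v w.
Proof. by have /= := fB.1 w a v 0; rewrite f0 !addr0. Qed.
Let fr0 v : f v 0 = 0.
Proof. by have /= := fB.2 v (-1) 0 0; rewrite scaler0 addr0 scaleN1r addNr. Qed.
Let fZr a v w : f v (a *: w) = a *: f v w.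
Proof. by have /= := fB.2 v a w 0; rewrite fr0 !addr0. Qed.

Lemma tens_lift_pi s :
  tens_lift f (\pi_(V ⊗ W) s) = \sum_(p <- s) f p.1 p.2.
Proof.
suff h s1 s2 : tens_rel s1 s2 ->
    \sum_(p <- s1) f p.1 p.2 = \sum_(p <- s2) f p.1 p.2.
  by apply: h; exact: tens_rel_repr.
elim=> {s1 s2} //= [s1 s2 u _ -> //|s1 s2 t1 t2 _ h1 _ h2|s1 s2|w|v v' w|v w w'|a v w].
- by rewrite !big_cat /= h1 h2.
- by rewrite !big_cat /= addrC.
- by rewrite big_seq1 big_nil f0.
- by rewrite !big_cons !big_nil !addr0 /= fDl.
- by rewrite !big_cons !big_nil !addr0 /= fDr.
- by rewrite !big_seq1 /= fZl fZr.
Qed.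

Lemma tens_liftE v w : tens_lift f (v ⊗ₜ w) = f v w.
Proof. by rewrite tens_lift_pi big_seq1. Qed.

Lemma tens_lift_linear : linear (tens_lift f).
Proof.
move=> a; elim/tens_quotP=> s; elim/tens_quotP=> t.
rewrite -[_ + _ in LHS]/(tens_add (tens_scale _ _) _) tens_scaleE tens_addE !tens_lift_pi.
rewrite big_cat big_map scaler_sumr; congr (_ + _).
by apply: eq_bigr => p _; rewrite fZl.
Qed.

End Theory.

Lemma linear_tens_ext (g h : {linear V ⊗ W -> U}) :
  (forall v w, g (v ⊗ₜ w) = h (v ⊗ₜ w)) -> g =1 h.
Proof.
move=> gh x; elim/tens_ind: x => [|v w x IHx]; first by rewrite !linear0.
by rewrite !linearD gh IHx.
Qed.

End TensorLift.

Section TensorMaps.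
Variable k : fieldType.
Implicit Types A B D E U V W : lmodType k.

(* multilinearity in a parameter of the map being lifted *)
Lemma tens_lift_param U V W D (F : D -> V -> W -> U) x :
  (forall v w, linear (fun d => F d v w)) ->
  linear (fun d => tens_lift (F d) x).
Proof.
move=> FL a d e; rewrite /tens_lift scaler_sumr -big_split /=.
by apply: eq_bigr => p _; rewrite FL.
Qed.

Lemma tens_linearl V W (w : W) : linear (fun v : V => v ⊗ₜ w).
Proof. by move=> a x y; rewrite (tens_bilinear V W).1. Qed.

Lemma tens_linearr V W (v : V) : linear (fun w : W => v ⊗ₜ w).
Proof. by move=> a x y; rewrite (tens_bilinear V W).2. Qed.

Definition tens_map V V' W W' (f : V -> V') (g : W -> W') :
  V ⊗ W -> V' ⊗ W' := tens_lift (fun v w => f v ⊗ₜ g w).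

Section Map.
Variables (V V' W W' : lmodType k).
Variables (f : {linear V -> V'}) (g : {linear W -> W'}).
Lemma tens_map_bilinear : bilinear_for *:%R *:%R (fun v w => f v ⊗ₜ g w).
Proof.
by split=> [w|v] a x y /=; rewrite linearP (tens_linearl, tens_linearr).
Qed.
Lemma tens_mapE v w : tens_map f g (v ⊗ₜ w) = f v ⊗ₜ g w.
Proof. exact: tens_liftE tens_map_bilinear _ _. Qed.
HB.instance Definition _ := GRing.isLinear.Build k (V ⊗ W) (V' ⊗ W') _
  (tens_map f g) (tens_lift_linear tens_map_bilinear).
End Map.

Definition tens_assoc U V W : U ⊗ V ⊗ W -> U ⊗ (V ⊗ W) :=
  tens_lift (fun t w => tens_lift (fun u v => u ⊗ₜ (v ⊗ₜ w)) t).

Section Assoc.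
Variables (U V W : lmodType k).
Lemma tens_assoc_bilinear1 w :
  bilinear_for *:%R *:%R (fun (u : U) (v : V) => u ⊗ₜ (v ⊗ₜ (w : W))).
Proof.
split=> [v|u] a x y /=; first by rewrite tens_linearl.
by rewrite tens_linearl tens_linearr.
Qed.
Lemma tens_assoc_bilinear : bilinear_for *:%R *:%R
  (fun t (w : W) => tens_lift (fun (u : U) (v : V) => u ⊗ₜ (v ⊗ₜ w)) t).
Proof.
split=> [w|t]; first exact: tens_lift_linear (tens_assoc_bilinear1 w).
by apply: tens_lift_param => u v a x y; rewrite !tens_linearr.
Qed.
Lemma tens_assocE (u : U) (v : V) (w : W) :
  tens_assoc (u ⊗ₜ v ⊗ₜ w) = u ⊗ₜ (v ⊗ₜ w).
Proof.
rewrite /tens_assoc (tens_liftE tens_assoc_bilinear).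
exact: tens_liftE (tens_assoc_bilinear1 w) _ _.
Qed.
HB.instance Definition _ := GRing.isLinear.Build k _ _ _
  (@tens_assoc U V W) (tens_lift_linear tens_assoc_bilinear).
End Assoc.

Definition tens_assocV U V W : U ⊗ (V ⊗ W) -> U ⊗ V ⊗ W :=
  tens_lift (fun u t => tens_lift (fun v w => u ⊗ₜ v ⊗ₜ w) t).

Section AssocV.
Variables (U V W : lmodType k).
Lemma tens_assocV_bilinear1 (u : U) :
  bilinear_for *:%R *:%R (fun (v : V) (w : W) => u ⊗ₜ v ⊗ₜ w).
Proof.
split=> [w|v] a x y /=; last by rewrite tens_linearr.
by rewrite tens_linearr tens_linearl.
Qed.
Lemma tens_assocV_bilinear : bilinear_for *:%R *:%R
  (fun (u : U) t => tens_lift (fun (v : V) (w : W) => u ⊗ₜ v ⊗ₜ w) t).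
Proof.
split=> [t|u]; last exact: tens_lift_linear (tens_assocV_bilinear1 u).
by apply: tens_lift_param => v w a x y; rewrite !tens_linearl.
Qed.
Lemma tens_assocVE (u : U) (v : V) (w : W) :
  tens_assocV (u ⊗ₜ (v ⊗ₜ w)) = u ⊗ₜ v ⊗ₜ w.
Proof.
rewrite /tens_assocV (tens_liftE tens_assocV_bilinear).
exact: tens_liftE (tens_assocV_bilinear1 u) _ _.
Qed.
HB.instance Definition _ := GRing.isLinear.Build k _ _ _
  (@tens_assocV U V W) (tens_lift_linear tens_assocV_bilinear).
End AssocV.

(* I ⊗ τ ⊗ I *)
Definition tens_mid A B D E : (A ⊗ B) ⊗ (D ⊗ E) -> (A ⊗ D) ⊗ (B ⊗ E) :=
  tens_lift (fun s t => tens_lift (fun a b =>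
    tens_lift (fun d e => (a ⊗ₜ d) ⊗ₜ (b ⊗ₜ e)) t) s).

Section Mid.
Variables (A B D E : lmodType k).
Lemma tens_mid_bilinear2 (a : A) (b : B) : bilinear_for *:%R *:%R
  (fun (d : D) (e : E) => (a ⊗ₜ d) ⊗ₜ (b ⊗ₜ e)).
Proof.
split=> [e|d] r x y /=; first by rewrite tens_linearr tens_linearl.
by rewrite !tens_linearr.
Qed.
Lemma tens_mid_bilinear1 t : bilinear_for *:%R *:%R (fun (a : A) (b : B) =>
  tens_lift (fun (d : D) (e : E) => (a ⊗ₜ d) ⊗ₜ (b ⊗ₜ e)) t).
Proof.
split=> [b|a]; apply: tens_lift_param => d e r x y; first by rewrite !tens_linearl.
by rewrite tens_linearl tens_linearr.
Qed.
Lemma tens_mid_bilinear : bilinear_for *:%R *:%R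
  (fun (s : A ⊗ B) (t : D ⊗ E) => tens_lift (fun a b =>
    tens_lift (fun d e => (a ⊗ₜ d) ⊗ₜ (b ⊗ₜ e)) t) s).
Proof.
split=> [t|s]; first exact: tens_lift_linear (tens_mid_bilinear1 t).
apply: tens_lift_param => a b.
exact: tens_lift_linear (tens_mid_bilinear2 a b).
Qed.
Lemma tens_midE (a : A) (b : B) (d : D) (e : E) :
  tens_mid ((a ⊗ₜ b) ⊗ₜ (d ⊗ₜ e)) = (a ⊗ₜ d) ⊗ₜ (b ⊗ₜ e).
Proof.
rewrite /tens_mid (tens_liftE tens_mid_bilinear).
rewrite (tens_liftE (tens_mid_bilinear1 _)).
exact: tens_liftE (tens_mid_bilinear2 _ _) _ _.
Qed.
HB.instance Definition _ := GRing.isLinear.Build k _ _ _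
  (@tens_mid A B D E) (tens_lift_linear tens_mid_bilinear).
End Mid.

(* The maps f ⊗ I and I ⊗ g for linear forms f and g, composed with the       *)
(* canonical isomorphisms k ⊗ W = W and V ⊗ k = V.                            *)
Definition tens_contrl V W (f : V -> k) : V ⊗ W -> W :=
  tens_lift (fun v w => f v *: w).
Definition tens_contrr V W (g : W -> k) : V ⊗ W -> V :=
  tens_lift (fun v w => g w *: v).

Section Contr.
Variables (V W : lmodType k) (f : {linear V -> k^o}) (g : {linear W -> k^o}).
Lemma tens_contrl_bilinear :
  bilinear_for *:%R *:%R (fun (v : V) (w : W) => (f v : k) *: w).
Proof.
split=> [w|v] a x y /=; first by rewrite linearP scalerDl scalerA.
by rewrite scalerDr !scalerA mulrC.
Qed.
Lemma tens_contrlE (v : V) (w : W) : tens_contrl f (v ⊗ₜ w) = (f v : k) *: w.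
Proof. exact: tens_liftE tens_contrl_bilinear _ _. Qed.
HB.instance Definition _ := GRing.isLinear.Build k (V ⊗ W) W _
  (tens_contrl f) (tens_lift_linear tens_contrl_bilinear).

Lemma tens_contrr_bilinear :
  bilinear_for *:%R *:%R (fun (v : V) (w : W) => (g w : k) *: v).
Proof.
split=> [w|v] a x y /=; last by rewrite linearP scalerDl scalerA.
by rewrite scalerDr !scalerA mulrC.
Qed.
Lemma tens_contrrE (v : V) (w : W) : tens_contrr g (v ⊗ₜ w) = (g w : k) *: v.
Proof. exact: tens_liftE tens_contrr_bilinear _ _. Qed.
HB.instance Definition _ := GRing.isLinear.Build k (V ⊗ W) V _
  (tens_contrr g) (tens_lift_linear tens_contrr_bilinear).
End Contr.

End TensorMaps.

(* Unital associative k-algebras. The algebra structures of the library, such *)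
(* as [algType], require 1 != 0 and so exclude the dual of the zero coalgebra. *)
HB.mixin Record isUnitalAlgebra (k : fieldType) A of GRing.Lmodule k A := {
  amul : A -> A -> A;
  aone : A;
  amul_bilinear : bilinear_for *:%R *:%R amul;
  amulA : associative amul;
  amul1l : left_id aone amul;
  amul1r : right_id aone amul }.

#[short(type="unitalAlgType")]
HB.structure Definition UnitalAlgebra (k : fieldType) :=
  { A of isUnitalAlgebra k A & GRing.Lmodule k A }.

Notation "x ∗ y" := (amul x y) : ring_scope.
Notation "𝟙" := aone : ring_scope.

Section AlgebraTheory.
Variable k : fieldType.

Definition tens_mul (A : unitalAlgType k) : A ⊗ A -> A :=
  tens_lift (@amul k A).

Section Mul.
Variable A : unitalAlgType k.
Lemma tens_mulE (x y : A) : tens_mul (x ⊗ₜ y) = x ∗ y.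
Proof. exact: tens_liftE amul_bilinear _ _. Qed.
HB.instance Definition _ := GRing.isLinear.Build k (A ⊗ A) A _
  (@tens_mul A) (tens_lift_linear amul_bilinear).
End Mul.

HB.instance Definition _ (A : unitalAlgType k) :=
  bilinear_isBilinear.Build k A A A _ _ (@amul k A) amul_bilinear.

Section TensorAlgebra.
Variables A B : unitalAlgType k.

Definition tens_prod (x y : A ⊗ B) : A ⊗ B :=
  tens_map (@tens_mul A) (@tens_mul B) (tens_mid (x ⊗ₜ y)).
Definition tens_one : A ⊗ B := 𝟙 ⊗ₜ 𝟙.

Lemma tens_prodE (a a' : A) (b b' : B) :
  tens_prod (a ⊗ₜ b) (a' ⊗ₜ b') = (a ∗ a') ⊗ₜ (b ∗ b').
Proof. by rewrite /tens_prod tens_midE tens_mapE /= !tens_mulE. Qed.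

Lemma tens_prod_linearl y : linear (fun x => tens_prod x y).
Proof. by move=> a u v; rewrite /tens_prod tens_linearl !linearP. Qed.
Lemma tens_prod_linearr x : linear (tens_prod x).
Proof. by move=> a u v; rewrite /tens_prod tens_linearr !linearP. Qed.

Lemma tens_prodDl : left_distributive tens_prod +%R.
Proof.
by move=> x y z; have := tens_prod_linearl z 1 x y; rewrite !scale1r.
Qed.
Lemma tens_prodDr : right_distributive tens_prod +%R.
Proof.
by move=> x y z; have := tens_prod_linearr x 1 y z; rewrite !scale1r.
Qed.
Lemma tens_prod0l x : tens_prod 0 x = 0.
Proof. by apply: (addrI (tens_prod 0 x)); rewrite -tens_prodDl !addr0. Qed.
Lemma tens_prod0r x : tens_prod x 0 = 0.
Proof. by apply: (addrI (tens_prod x 0)); rewrite -tens_prodDr !addr0. Qed.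

Lemma tens_prodA : associative tens_prod.
Proof.
elim/tens_ind=> [|a b x IHx] y z; first by rewrite !tens_prod0l.
rewrite !tens_prodDl IHx; congr (_ + _).
elim/tens_ind: y z {IHx} => [|a' b' y IHy] z; first by rewrite !(tens_prod0l, tens_prod0r).
rewrite !(tens_prodDl, tens_prodDr) IHy; congr (_ + _).
elim/tens_ind: z {IHy} => [|a'' b'' z IHz]; first by rewrite !tens_prod0r.
by rewrite !tens_prodDr IHz !tens_prodE !amulA.
Qed.
Lemma tens_prod1l : left_id tens_one tens_prod.
Proof.
elim/tens_ind=> [|a b x IHx]; first by rewrite tens_prod0r.
by rewrite tens_prodDr IHx tens_prodE !amul1l.
Qed.
Lemma tens_prod1r : right_id tens_one tens_prod.
Proof.
elim/tens_ind=> [|a b x IHx]; first by rewrite tens_prod0l.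
by rewrite tens_prodDl IHx tens_prodE !amul1r.
Qed.

Lemma tens_prod_bilinear : bilinear_for *:%R *:%R tens_prod.
Proof. by split; [exact: tens_prod_linearl | exact: tens_prod_linearr]. Qed.

HB.instance Definition _ := isUnitalAlgebra.Build k (A ⊗ B)
  tens_prod_bilinear tens_prodA tens_prod1l tens_prod1r.

Lemma mul_tens (a a' : A) (b b' : B) :
  (a ⊗ₜ b) ∗ (a' ⊗ₜ b') = (a ∗ a') ⊗ₜ (b ∗ b') :> A ⊗ B.
Proof. exact: tens_prodE. Qed.

End TensorAlgebra.
End AlgebraTheory.

HB.mixin Record isCoalgebra (k : fieldType) C of GRing.Lmodule k C := {
  comul : {linear C -> C ⊗ C};
  counit : {linear C -> k^o};
  comulA : forall c : C,
    tens_assoc (tens_map comul idfun (comul c)) = tens_map idfun comul (comul c);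
  counitl : forall c : C, tens_contrl counit (comul c) = c;
  counitr : forall c : C, tens_contrr counit (comul c) = c }.

#[short(type="coalgType")]
HB.structure Definition Coalgebra (k : fieldType) :=
  { C of isCoalgebra k C & GRing.Lmodule k C }.

HB.mixin Record isHopf (k : fieldType) H of UnitalAlgebra k H & Coalgebra k H := {
  comulM : forall x y : H, comul (x ∗ y) = comul x ∗ comul y;
  comul1 : comul (𝟙 : H) = 𝟙 ⊗ₜ 𝟙;
  counitM : forall x y : H, counit (x ∗ y) = (counit x : k) * counit y;
  counit1 : counit (𝟙 : H) = (1 : k);
  antipode : {linear H -> H};
  antipodel : forall x : H,
    tens_mul (tens_map antipode idfun (comul x)) = (counit x : k) *: 𝟙;
  antipoder : forall x : H,
    tens_mul (tens_map idfun antipode (comul x)) = (counit x : k) *: 𝟙 }.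

#[short(type="hopfAlgType")]
HB.structure Definition HopfAlgebra (k : fieldType) :=
  { H of isHopf k H & UnitalAlgebra k H & Coalgebra k H }.

#[short(type="finHopfAlgType")]
HB.structure Definition FinHopfAlgebra (k : fieldType) :=
  { H of HopfAlgebra k H & Vector k H }.

Section LinearDual.
Variables (k : fieldType) (V : lmodType k).

Definition is_scalar : {pred V -> k^o} := [pred f | `[< linear f >]].

Lemma is_scalar_submod : submod_closed is_scalar.
Proof.
split=> [|a f g /asboolP fL /asboolP gL]; apply/asboolP=> b u v.
  by rewrite /= addr0 scaler0.
change (a *: f (b *: u + v) + g (b *: u + v) =
        b *: (a *: f u + g u) + (a *: f v + g v)).
rewrite fL gL !scalerDr !scalerA (mulrC b) -!addrA; congr (_ + _).
by rewrite addrCA.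
Qed.
HB.instance Definition _ :=
  GRing.isSubmodClosed.Build k (V -> k^o) is_scalar is_scalar_submod.

(* the dual space V^* *)
Record ldual : Type := LDual { ldual_fun :> V -> k^o; _ : ldual_fun \in is_scalar }.
HB.instance Definition _ := [isSub for ldual_fun].
HB.instance Definition _ := [Choice of ldual by <:].
HB.instance Definition _ := [SubChoice_isSubLmodule of ldual by <:].

Lemma ldual_linear (f : ldual) : linear f.
Proof. by apply/asboolP; exact: (valP f). Qed.
HB.instance Definition _ (f : ldual) :=
  GRing.isLinear.Build k V k^o _ f (ldual_linear f).

Lemma ldualP (f g : ldual) : f =1 g -> f = g.
Proof. by move=> fg; apply: val_inj; apply: funext => x; exact: fg. Qed.

Lemma ldual_pred (f : {linear V -> k^o}) : (f : V -> k^o) \in is_scalar.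
Proof. by apply/asboolP; exact: linearP. Qed.
Definition to_ldual (f : {linear V -> k^o}) : ldual := LDual (ldual_pred f).

Lemma ldualD (f g : ldual) x : (f + g) x = f x + g x. Proof. by []. Qed.
Lemma ldualZ a (f : ldual) x : (a *: f) x = a *: f x. Proof. by []. Qed.
Lemma ldual0 x : (0 : ldual) x = 0. Proof. by []. Qed.
Lemma ldual_sum I r (P : pred I) (F : I -> ldual) x :
  (\sum_(i <- r | P i) F i) x = \sum_(i <- r | P i) F i x.
Proof. by elim/big_rec2: _ => [|i y z _ <-]. Qed.

Definition ldual_eval (v : V) : ldual -> k^o := fun f => f v.
Lemma ldual_eval_linear v : linear (ldual_eval v).
Proof. by []. Qed.
HB.instance Definition _ v :=
  GRing.isLinear.Build k ldual k^o _ (ldual_eval v) (ldual_eval_linear v).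

End LinearDual.

(* f ⊗ g as a linear form on V ⊗ W *)
Section TensorForm.
Variable k : fieldType.

Definition tens_form (V W : lmodType k) (f : V -> k) (g : W -> k) : V ⊗ W -> k^o :=
  tens_lift (fun v w => f v * g w : k^o).

Section Form.
Variables (V W : lmodType k) (f : {linear V -> k^o}) (g : {linear W -> k^o}).
Lemma tens_form_bilinear :
  bilinear_for *:%R *:%R (fun (v : V) (w : W) => (f v : k) * g w : k^o).
Proof.
split=> [w|v] a x y /=; rewrite linearP.
  by rewrite mulrDl; congr (_ + _); exact: esym (mulrA _ _ _).
by rewrite mulrDr; congr (_ + _); exact: mulrCA.
Qed.
Lemma tens_formE (v : V) (w : W) : tens_form f g (v ⊗ₜ w) = (f v : k) * g w.
Proof. exact: tens_liftE tens_form_bilinear _ _. Qed.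
HB.instance Definition _ := GRing.isLinear.Build k (V ⊗ W) k^o _
  (tens_form f g) (tens_lift_linear tens_form_bilinear).
End Form.

Lemma tens_form_map (V V' W W' : lmodType k) (f : {linear V' -> k^o})
    (g : {linear W' -> k^o}) (h : {linear V -> V'}) (l : {linear W -> W'}) x :
  tens_form f g (tens_map h l x) = tens_form (f \o h) (g \o l) x.
Proof.
elim/tens_ind: x => [|v w x IHx]; first by rewrite !linear0.
by rewrite !linearD /= IHx tens_mapE !tens_formE.
Qed.

Lemma tens_form_linearl (V W : lmodType k) (g : ldual W) x :
  linear (fun f : ldual V => tens_form f g x : k^o).
Proof.
pose F (f : ldual V) v w : k^o := (f v : k) * g w.
suff FL (v : V) (w : W) : linear (fun f => F f v w) by exact: (@tens_lift_param k k^o V W _ F x FL).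
move=> a u u'; rewrite /F /=.
by rewrite mulrDl; congr (_ + _); exact: esym (mulrA _ _ _).
Qed.
Lemma tens_form_linearr (V W : lmodType k) (f : ldual V) x :
  linear (fun g : ldual W => tens_form f g x : k^o).
Proof.
pose F (g : ldual W) v w : k^o := (f v : k) * g w.
suff FL (v : V) (w : W) : linear (fun g => F g v w) by exact: (@tens_lift_param k k^o V W _ F x FL).
move=> a u u'; rewrite /F /=.
by rewrite mulrDr; congr (_ + _); exact: mulrCA.
Qed.

End TensorForm.

Section Convolution.
Variables (k : fieldType) (C : coalgType k).
Implicit Types f g h : ldual C.

(* the convolution product of C^* : (f ∗ g)(c) = f(c_1) g(c_2) *)
Definition conv f g : ldual C := to_ldual (tens_form f g \o comul).

Lemma convE f g c : conv f g c = tens_form f g (comul c).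
Proof. by []. Qed.

Lemma conv_bilinear : bilinear_for *:%R *:%R conv.
Proof.
split=> [g|f] a u v; apply: ldualP => c.
  exact: tens_form_linearl.
exact: tens_form_linearr.
Qed.

Lemma convA : associative conv.
Proof.
move=> f g h; apply: ldualP => c; rewrite !convE.
transitivity (tens_form f (tens_form g h) (tens_map idfun comul (comul c))).
  by rewrite tens_form_map.
rewrite -comulA [RHS](_ : _ =
  tens_form (tens_form f g) h (tens_map comul idfun (comul c))); last first.
  by rewrite tens_form_map.
elim/tens_ind: (tens_map _ _ _) => [|t w x IHx]; first by rewrite !linear0.
rewrite !linearD /= IHx; congr (_ + _).
elim/tens_ind: t => [|u v t IHt].
  by rewrite linear0l !linear0.
rewrite linearDl !linearD /= IHt; congr (_ + _).
rewrite tens_assocE !tens_formE /=.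
by rewrite !tens_formE mulrA.
Qed.

Definition conv1 : ldual C := to_ldual (@counit k C).

Lemma conv1l : left_id conv1 conv.
Proof.
move=> f; apply: ldualP => c; rewrite convE -{2}(counitl c).
elim/tens_ind: (comul c) => [|v w x IHx]; first by rewrite !linear0.
by rewrite !linearD /= IHx tens_formE /= tens_contrlE linearZ.
Qed.
Lemma conv1r : right_id conv1 conv.
Proof.
move=> f; apply: ldualP => c; rewrite convE -{2}(counitr c).
elim/tens_ind: (comul c) => [|v w x IHx]; first by rewrite !linear0.
by rewrite !linearD /= IHx tens_formE /= tens_contrrE linearZ mulrC.
Qed.

HB.instance Definition _ := isUnitalAlgebra.Build k (ldual C)
  conv_bilinear convA conv1l conv1r.

Lemma ldual_mulE f g c : (f ∗ g) c = tens_form f g (comul c).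
Proof. by []. Qed.
Lemma ldual_oneE c : (𝟙 : ldual C) c = counit c.
Proof. by []. Qed.

End Convolution.

(* The dual of a finite-dimensional Hopf algebra. Its product is the          *)
(* convolution product above; its coproduct is the transpose of the product   *)
(* of H through (H ⊗ H)^* = H^* ⊗ H^*, i.e. f_1(x) f_2(y) = f(xy), written    *)
(* below in dual bases (e_i) and (e^i); see [ldual_comulE].                   *)
Section DualHopf.
Variables (k : fieldType) (H : finHopfAlgType k).
Implicit Types (f g : ldual H) (x y z : H).

Local Notation n := (\dim {:H}).
Local Notation e i := ((vbasis {:H})`_i).

Lemma coord_is_scalar_form (i : 'I_n) :
  (coord (vbasis {:H}) i : H -> k^o) \in @is_scalar k H.
Proof. by apply/asboolP; exact: coord_is_scalar. Qed.
Definition dual_basis (i : 'I_n) : ldual H := LDual (coord_is_scalar_form i).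

Definition ldual_comul f : ldual H ⊗ ldual H :=
  \sum_(i < n) \sum_(j < n) (f (e i ∗ e j) : k) *: (dual_basis i ⊗ₜ dual_basis j).

Definition ldual_counit f : k^o := f 𝟙.

Definition ldual_antipode f : ldual H := to_ldual (f \o antipode).

Lemma ldual_comul_linear : linear ldual_comul.
Proof.
move=> a f g; rewrite /ldual_comul scaler_sumr -big_split; apply: eq_bigr => i _.
rewrite /= scaler_sumr -big_split; apply: eq_bigr => j _.
by rewrite /= scalerA -scalerDl.
Qed.
HB.instance Definition _ := GRing.isLinear.Build k (ldual H) (ldual H ⊗ ldual H) _
  ldual_comul ldual_comul_linear.

Lemma ldual_counit_linear : linear ldual_counit.
Proof. by []. Qed.
HB.instance Definition _ := GRing.isLinear.Build k (ldual H) k^o _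
  ldual_counit ldual_counit_linear.

Lemma ldual_antipode_linear : linear ldual_antipode.
Proof. by move=> a f g; apply: ldualP. Qed.
HB.instance Definition _ := GRing.isLinear.Build k (ldual H) (ldual H) _
  ldual_antipode ldual_antipode_linear.

Lemma basis_expand x : x = \sum_(i < n) (dual_basis i x : k) *: e i.
Proof. exact: coord_vbasis (memvf x). Qed.

Lemma ldual_expand f : f = \sum_(i < n) (f (e i) : k) *: dual_basis i.
Proof.
apply: ldualP => x; rewrite {1}(basis_expand x) linear_sum ldual_sum.
by apply: eq_bigr => i _; rewrite linearZ; exact: mulrC.
Qed.

Lemma ldual_comulE f x y :
  tens_form (ldual_eval x) (ldual_eval y) (ldual_comul f) = f (x ∗ y).
Proof.
rewrite /ldual_comul linear_sum {2}(basis_expand x) linear_sumlz linear_sum.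
apply: eq_bigr => i _; rewrite linear_sum {2}(basis_expand y) linear_sumr linear_sum.
apply: eq_bigr => j _; rewrite linearZ /= tens_formE linearZl linearZr !linearZ /=.
by congr (_ *: _); exact: mulrC.
Qed.

Lemma ldual_tens_ext (W : lmodType k) (s t : ldual H ⊗ W) :
  (forall x, tens_contrl (ldual_eval x) s = tens_contrl (ldual_eval x) t) ->
  s = t.
Proof.
suff expand u : u = \sum_(i < n) dual_basis i ⊗ₜ
    tens_contrl (ldual_eval (e i)) (u : ldual H ⊗ W).
  by move=> st; rewrite (expand s) (expand t); apply: eq_bigr => i _; rewrite st.
elim/tens_ind: u => [|f w u IHu].
  by rewrite big1 // => i _; rewrite linear0 linear0r.
under eq_bigr do rewrite linearD linearDr.
rewrite big_split /= -IHu; congr (_ + _).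
rewrite {1}(ldual_expand f) linear_sumlz; apply: eq_bigr => i _.
by rewrite tens_contrlE linearZl linearZr.
Qed.

Lemma tens_form_contrl (V W : lmodType k) (h : {linear V -> k^o})
    (l : {linear W -> k^o}) t :
  tens_form h l t = l (tens_contrl h t).
Proof.
elim/tens_ind: t => [|v w t IHt]; first by rewrite !linear0.
by rewrite !linearD /= IHt tens_formE tens_contrlE linearZ.
Qed.

Lemma tens_form_assoc (U V W : lmodType k) (h : {linear U -> k^o})
    (l : {linear V -> k^o}) (m : {linear W -> k^o}) t :
  tens_form h (tens_form l m) (tens_assoc t) = tens_form (tens_form h l) m t.
Proof.
elim/tens_ind: t => [|t w s IHs]; first by rewrite !linear0.
rewrite !linearD /= IHs; congr (_ + _).
elim/tens_ind: t {IHs} => [|u v t IHt]; first by rewrite linear0l !linear0.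
rewrite linearDl !linearD /= IHt; congr (_ + _).
by rewrite tens_assocE !tens_formE /= !tens_formE mulrA.
Qed.

Lemma ldual_tens2_ext (s t : ldual H ⊗ ldual H) :
  (forall x y, tens_form (ldual_eval x) (ldual_eval y) s =
               tens_form (ldual_eval x) (ldual_eval y) t) -> s = t.
Proof.
move=> st; apply: ldual_tens_ext => x; apply: ldualP => y.
by have := st x y; rewrite !tens_form_contrl.
Qed.

Lemma ldual_comulA f :
  tens_assoc (tens_map ldual_comul idfun (ldual_comul f)) =
  tens_map idfun ldual_comul (ldual_comul f).
Proof.
apply: ldual_tens_ext => x; apply: ldual_tens2_ext => y z.
rewrite -!tens_form_contrl tens_form_assoc !tens_form_map.
have -> : tens_form (ldual_eval x) (ldual_eval y) \o ldual_comul =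
    ldual_eval (x ∗ y) by apply: funext => g; exact: ldual_comulE.
have -> : tens_form (ldual_eval y) (ldual_eval z) \o ldual_comul =
    ldual_eval (y ∗ z) by apply: funext => g; exact: ldual_comulE.
by rewrite !ldual_comulE amulA.
Qed.

Lemma ldual_counitl f : tens_contrl ldual_counit (ldual_comul f) = f.
Proof.
apply: ldualP => x; rewrite -{2}[x]amul1l -ldual_comulE.
by rewrite tens_form_contrl.
Qed.

Lemma ldual_counitr f : tens_contrr ldual_counit (ldual_comul f) = f.
Proof.
apply: ldualP => x; rewrite -{2}[x]amul1r -ldual_comulE.
elim/tens_ind: (ldual_comul f) => [|g h t IHt]; first by rewrite !linear0.
rewrite [tens_contrr _ _]linearD ldualD IHt linearD; congr (_ + _).
rewrite /= tens_formE tens_contrrE ldualZ; exact: mulrC.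
Qed.

HB.instance Definition _ := isCoalgebra.Build k (ldual H)
  ldual_comulA ldual_counitl ldual_counitr.

Lemma tens_sum (V W : lmodType k) (t : V ⊗ W) :
  t = \sum_(p <- repr t) p.1 ⊗ₜ p.2.
Proof. by rewrite -tens_piE reprK. Qed.

Lemma ldual_mul_form (s t : ldual H ⊗ ldual H) x y :
  tens_form (ldual_eval x) (ldual_eval y) (s ∗ t) =
  \sum_(p <- repr (comul x)) \sum_(q <- repr (comul y))
    (tens_form (ldual_eval p.1) (ldual_eval q.1) s : k) *
    tens_form (ldual_eval p.2) (ldual_eval q.2) t.
Proof.
elim/tens_ind: s => [|f f' s IHs].
  rewrite linear0l linear0 big1 // => p _; rewrite big1 // => q _.
  by rewrite linear0 mul0r.
rewrite linearDl linearD /= IHs.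
under [RHS]eq_bigr do under eq_bigr do rewrite linearD mulrDl.
under [RHS]eq_bigr do rewrite big_split.
rewrite [RHS]big_split /=; congr (_ + _).
elim/tens_ind: t {IHs} => [|g g' t IHt].
  rewrite linear0r linear0 big1 // => p _; rewrite big1 // => q _.
  by rewrite linear0 mulr0.
rewrite linearDr linearD /= IHt.
under [RHS]eq_bigr do under eq_bigr do rewrite linearD mulrDr.
under [RHS]eq_bigr do rewrite big_split.
rewrite [RHS]big_split /=; congr (_ + _).
rewrite mul_tens tens_formE /=.
rewrite {1}(tens_sum (comul x)) {1}(tens_sum (comul y)) !linear_sum /= mulr_suml.
apply: eq_bigr => p _; rewrite mulr_sumr; apply: eq_bigr => q _.
by rewrite !tens_formE /= mulrACA.
Qed.

Lemma ldual_comulM f g : comul (f ∗ g) = comul f ∗ comul g.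
Proof.
apply: ldual_tens2_ext => x y; rewrite ldual_comulE ldual_mul_form ldual_mulE.
rewrite comulM {1}(tens_sum (comul x)) {1}(tens_sum (comul y)) linear_sumlz linear_sum.
apply: eq_bigr => p _; rewrite linear_sumr linear_sum; apply: eq_bigr => q _.
by rewrite /= mul_tens !ldual_comulE tens_formE.
Qed.

Lemma ldual_comul1 : comul (𝟙 : ldual H) = 𝟙 ⊗ₜ 𝟙.
Proof.
apply: ldual_tens2_ext => x y; rewrite ldual_comulE tens_formE !ldual_oneE.
exact: counitM.
Qed.

Lemma ldual_counitM f g : counit (f ∗ g) = (counit f : k) * counit g.
Proof.
transitivity (tens_form f g (comul (𝟙 : H))); first by [].
by rewrite comul1 tens_formE.
Qed.

Lemma ldual_counit1 : counit (𝟙 : ldual H) = (1 : k).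
Proof. exact: counit1. Qed.

Lemma ldual_mul_eval (t : ldual H ⊗ ldual H) x :
  tens_mul t x = \sum_(p <- repr (comul x))
    tens_form (ldual_eval p.1) (ldual_eval p.2) t.
Proof.
elim/tens_ind: t => [|f g t IHt].
  by rewrite linear0 big1 // => p _; rewrite linear0.
rewrite linearD ldualD IHt; under [RHS]eq_bigr do rewrite linearD.
rewrite [RHS]big_split /=; congr (_ + _).
rewrite tens_mulE ldual_mulE {1}(tens_sum (comul x)) linear_sum.
by apply: eq_bigr => p _; rewrite /= !tens_formE.
Qed.

Lemma ldual_antipodel f :
  tens_mul (tens_map ldual_antipode idfun (comul f)) = (counit f : k) *: 𝟙.
Proof.
apply: ldualP => x; rewrite ldual_mul_eval ldualZ ldual_oneE.
under eq_bigr => p _ do rewrite tens_form_map -[_ \o ldual_antipode]/(ldual_eval (antipode p.1)) ldual_comulE.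
transitivity (f (tens_mul (tens_map antipode idfun (comul x)))).
  rewrite {2}(tens_sum (comul x)) (linear_sum (tens_map antipode idfun)).
  rewrite (linear_sum (@tens_mul k H)) linear_sum; apply: eq_bigr => p _.
  by rewrite /= tens_mapE /= tens_mulE.
by rewrite antipodel linearZ; exact: mulrC.
Qed.

Lemma ldual_antipoder f :
  tens_mul (tens_map idfun ldual_antipode (comul f)) = (counit f : k) *: 𝟙.
Proof.
apply: ldualP => x; rewrite ldual_mul_eval ldualZ ldual_oneE.
under eq_bigr => p _ do rewrite tens_form_map -[_ \o ldual_antipode]/(ldual_eval (antipode p.2)) ldual_comulE.
transitivity (f (tens_mul (tens_map idfun antipode (comul x)))).
  rewrite {2}(tens_sum (comul x)) (linear_sum (tens_map idfun antipode)).
  rewrite (linear_sum (@tens_mul k H)) linear_sum; apply: eq_bigr => p _.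
  by rewrite /= tens_mapE /= tens_mulE.
by rewrite antipoder linearZ; exact: mulrC.
Qed.

HB.instance Definition _ := isHopf.Build k (ldual H)
  ldual_comulM ldual_comul1 ldual_counitM ldual_counit1
  ldual_antipodel ldual_antipoder.

End DualHopf.

(* Partial (co)module structures. In the comments, sums are implicit in       *)
(* Δ(c) = c_1 ⊗ c_2.                                                          *)
Section PartialStructures.
Variable k : fieldType.

Record left_partial_comodule_coalgebra (H : hopfAlgType k) (C : coalgType k)
    (lambda : {linear C -> H ⊗ C}) : Prop := {
  lpcc_counit : forall c, tens_contrl (@counit k H) (lambda c) = c;
  lpcc_comul : forall c, tens_map idfun (@comul k C) (lambda c) =
    tens_map (@tens_mul k H) idfun
      (tens_mid (tens_map lambda lambda (comul c)));
  (* [tens_assoc] and [tens_assocV] rebracket H ⊗ ((H ⊗ H) ⊗ C) as            *)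
  (* (H ⊗ H) ⊗ (H ⊗ C); the map ∇ is [tens_contrr counit \o lambda].          *)
  lpcc_coact : forall c, tens_map idfun lambda (lambda c) =
    tens_map (@tens_mul k H) idfun (tens_assocV
      (tens_map (tens_contrr (@counit k C) \o lambda)
         (@tens_assoc k H H C \o tens_map (@comul k H) idfun \o lambda) (comul c))) }.

Record right_partial_comodule_algebra (H : hopfAlgType k) (A : unitalAlgType k)
    (rho : {linear A -> A ⊗ H}) : Prop := {
  rpca_counit : forall a, tens_contrr (@counit k H) (rho a) = a;
  rpca_mul : forall a b, rho (a ∗ b) = rho a ∗ rho b;
  rpca_coact : forall a, tens_map rho idfun (rho a) =
    (rho 𝟙 ⊗ₜ 𝟙) ∗ tens_assocV (tens_map idfun (@comul k H) (rho a)) }.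

Record right_partial_module_coalgebra (K : hopfAlgType k) (C : coalgType k)
    (act : {linear C ⊗ K -> C}) : Prop := {
  rpmc_one : forall c, act (c ⊗ₜ 𝟙) = c;
  rpmc_comul : forall c h, comul (act (c ⊗ₜ h)) =
    tens_map act act (tens_mid (comul c ⊗ₜ comul h));
  (* ε(c_1 ↼ h_1) (c_2 ↼ h_2 g) *)
  rpmc_act : forall c h g, act (act (c ⊗ₜ h) ⊗ₜ g) =
    tens_contrl (@counit k C \o act)
      (tens_map idfun (act \o tens_map idfun (fun x => x ∗ g))
         (tens_mid (comul c ⊗ₜ comul h))) }.

Record left_partial_module_algebra (K : hopfAlgType k) (A : unitalAlgType k)
    (act : {linear K ⊗ A -> A}) : Prop := {
  lpma_one : forall a, act (𝟙 ⊗ₜ a) = a;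
  (* (h_1 ⇀ a) (h_2 ⇀ b) *)
  lpma_mul : forall h a b, act (h ⊗ₜ (a ∗ b)) =
    tens_mul (tens_map act act (tens_mid (comul h ⊗ₜ (a ⊗ₜ b))));
  (* (h_1 ⇀ 1) (h_2 g ⇀ a) *)
  lpma_act : forall h g a, act (h ⊗ₜ act (g ⊗ₜ a)) =
    tens_mul (tens_map (fun x => act (x ⊗ₜ 𝟙)) (fun x => act ((x ∗ g) ⊗ₜ a))
      (comul h)) }.

End PartialStructures.

Definition finite_dimensional (k : fieldType) (V : lmodType k) : Prop :=
  exists s : seq V, forall v, exists a : 'I_(size s) -> k,
    v = \sum_(i < size s) a i *: s`_i.

Section Correspondence.
Variables (k : fieldType) (H : finHopfAlgType k) (C : coalgType k).
Variables (lambda : {linear C -> H ⊗ C}).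
Variables (rho : {linear ldual C -> ldual C ⊗ H}).
Variables (ract : {linear C ⊗ ldual H -> C}).
Variables (lact : {linear ldual H ⊗ ldual C -> ldual C}).

(* f ⇀ α = α^0 f(α^1) *)
Definition lact_of_rho : Prop :=
  forall (f : ldual H) (alpha : ldual C),
    lact (f ⊗ₜ alpha) = tens_contrr f (rho alpha).

Record corresponding : Prop := {
  (* α(c^0) c^-1 = α^0(c) α^1 *)
  corr_lambda_rho : forall (alpha : ldual C) (c : C),
    tens_contrr alpha (lambda c) = tens_contrl (ldual_eval c) (rho alpha);
  (* (f ⇀ α)(c) = α(c ↼ f) *)
  corr_lact_ract : forall (f : ldual H) (alpha : ldual C) (c : C),
    lact (f ⊗ₜ alpha) c = alpha (ract (c ⊗ₜ f));
  (* c ↼ f = f(c^-1) c^0 *)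
  corr_ract_lambda : forall (f : ldual H) (c : C),
    ract (c ⊗ₜ f) = tens_contrl f (lambda c);
  corr_lact_rho : lact_of_rho }.

End Correspondence.

(* Main.v *)
Require Import Defs.
From HB Require Import structures.
From mathcomp Require Import all_boot all_algebra.
From mathcomp Require Import boolp functions.
From mathcomp Require classical_sets.
Import GRing.Theory.
Local Open Scope ring_scope.
Set Implicit Arguments.
Unset Strict Implicit.

(** Each of the four structures is a list of identities between vectors, and
    the four structure maps determine each other by evaluation: [c ↼ f] is
    [f(c^-) c^0], [(f ⇀ α)(c)] is [α(c ↼ f)], and [f ⇀ α] is [α^0 f(α^+)].
    Two principles turn the identities of one structure into those of another.

    First, linear forms separate the points of a vector space and of a tensor
    product ([ldual_ext], [tens_contrl_ext], [tens_contrr_ext],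
    [tens_form_ext]). So an identity in [H ⊗ C ⊗ C], in [H ⊗ H ⊗ C] or in
    [C^* ⊗ H ⊗ H] may be tested by applying forms [f], [g] of [H^*] to its [H]
    factors, and an identity in [C ⊗ C] by applying forms [α ⊗ β]. As [C] may
    have infinite dimension, the separation rests on Zorn's lemma
    ([form_separating_subspace]); finitely many vectors at a time then have a
    system of coordinate forms ([dual_system]), which is what tensors need.

    Second, the structure of [H^*] is the transpose of that of [H]: the
    coproduct of [f] is defined by [f_1(x) f_2(y) = f(xy)], and
    [(f ∗ g)(x) = f(x_1) g(x_2)]. Hence applying [f] to a product in [H]
    produces the coproduct of [f], and applying [f ⊗ g] to a coproduct in [H]
    produces the product [f ∗ g]. Tested on forms, the axioms of a partial
    coaction become word for word those of the corresponding partial action: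
    - for [C]: Δ(c ↼ f) = (c_1 ↼ f_1) ⊗ (c_2 ↼ f_2) and
      (c ↼ f) ↼ g = ε(c_1 ↼ f_1) (c_2 ↼ f_2 g) ([comodule_module_coalgebra]);
    - for [C^*]: f ⇀ (α β) = (f_1 ⇀ α)(f_2 ⇀ β) and
      f ⇀ (g ⇀ α) = (f_1 ⇀ 1)(f_2 g ⇀ α) ([comodule_module_algebra]);
    - evaluating the axioms for [C^*] at points of [C] gives those for [C]
      tested on forms ([module_coalgebra_dual]).

    Corresponding maps exist because [H] has finite dimension: with dual bases
    [e_i] and [e^i], a coaction is recovered from an action as the sum of the
    [e_i ⊗ (c ↼ e^i)]. An action on [C^*] is a transpose when [C] has finite
    dimension, by the same formula with a dual system in [C]. *)

(** * Linear forms separate vectors *)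

Definition mk_linear (k : fieldType) (U V : lmodType k) (f : U -> V)
    (fL : linear f) : {linear U -> V} :=
  HB.pack f (GRing.isLinear.Build k U V _ f fL).

Section FormSeparation.
Variables (k : fieldType) (V : lmodType k).
Implicit Types (U M : V -> Prop) (s : seq V).

Definition subspace U := U 0 /\ forall a u v, U u -> U v -> U (a *: u + v).

Lemma subspaceZ U a u : subspace U -> U u -> U (a *: u).
Proof. by case=> U0 UP Uu; rewrite -[_ *: _]addr0; apply: UP. Qed.

Lemma subspaceB U u v : subspace U -> U u -> U v -> U (u - v).
Proof. by case=> U0 UP Uu Uv; rewrite addrC -scaleN1r; apply: UP. Qed.

(** A subspace that is maximal among those containing [U] and avoiding [x] is
    a hyperplane complementary to the line of [x]: if some [v] were outside
    [M + k x], then [M + k v] would be larger and would still avoid [x]. *)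
Lemma maximal_subspace_avoiding U x : subspace U -> ~ U x ->
  exists M, [/\ subspace M, (forall u, U u -> M u), ~ M x &
    forall v, exists a, M (v - a *: x)].
Proof.
move=> [U0 UP] Ux; pose join (A : V -> Prop) w := U w \/ A w.
pose P (A : V -> Prop) := subspace (join A) /\ ~ join A x.
(* Zorn is applied to the sets [A] such that [U \/ A] is a subspace avoiding
   [x], because the empty chain has the empty union. *)
have [F FP Ftot|A [[[M0 MP] Mx] Amax]] := @classical_sets.Zorn_bigcup V P.
  split; last by case=> // -[A FA Ax]; have [_] := FP _ FA; apply; right.
  split=> [|a u v Hu Hv]; first by left.
  have inF A : F A -> join A u -> join A v ->
      join (classical_sets.bigcup F id) (a *: u + v).
    move=> FA Au Av; have [[_ AP] _] := FP _ FA.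
    by case: (AP a u v Au Av) => [|h]; [left | right; exists A].
  case: Hu => [Uu|[A FA Au]]; case: Hv => [Uv|[B FB Bv]].
  - by left; apply: UP.
  - by apply: inF FB _ _; [left | right].
  - by apply: inF FA _ _; [right | left].
  - case: (Ftot _ _ FA FB) => sub.
      by apply: inF FB _ _; right; [apply: sub|].
    by apply: inF FA _ _; right; [|apply: sub].
have Msub : subspace (join A) by [].
exists (join A); split=> //; first by left.
move=> v; apply: contrapT => noa.
(* the subspace spanned by [join A] and [v] *)
pose B w := exists b, join A (w - b *: v).
have MB w : join A w -> B w by move=> Mw; exists 0; rewrite scale0r subr0.
have UB : join B = B.
  apply: funext => w; apply: propext.
  by split=> [[Uw|]|]; [apply/MB; left| |right].
apply: (Amax B).
  split=> [w Aw|BA]; first by apply: MB; right.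
  apply: noa; exists 0; rewrite scale0r subr0; right; apply: BA.
  by exists 1; rewrite scale1r subrr.
rewrite /P UB; split; first split; first exact: MB.
  move=> a u w [b Mu] [c Mw]; exists (a * b + c).
  have := MP a _ _ Mu Mw; congr (join A _).
  by rewrite scalerBr scalerDl scalerA opprD addrACA.
case=> b Mxb; have [b0|b0] := eqVneq b 0.
  by apply: Mx; move: Mxb; rewrite b0 scale0r subr0.
apply: noa; exists b^-1; have := subspaceZ (- b^-1) Msub Mxb.
by rewrite scalerBr !scaleNr scalerA mulVf // scale1r opprK addrC.
Qed.

(** The form sends [v] to its coordinate along [x] in the decomposition of the
    space as the line of [x] plus a maximal subspace avoiding [x]. *)
Lemma form_separating_subspace U x : subspace U -> ~ U x ->
  exists g : ldual V, (forall u, U u -> g u = 0) /\ g x = 1.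
Proof.
move=> Usub Ux; have [M [Msub UM Mx Mdec]] := maximal_subspace_avoiding Usub Ux.
pose g v : k^o := projT1 (cid (Mdec v)).
have gM v : M (v - g v *: x) by rewrite /g; case: cid.
have g_uniq v a : M (v - a *: x) -> g v = a.
  move=> Mv; apply/eqP; rewrite -subr_eq0; apply/negP => /negP nz; apply: Mx.
  have := subspaceZ (g v - a)^-1 Msub (subspaceB Msub Mv (gM v)).
  rewrite opprB [_ + (_ - v)]addrC addrA subrK -scalerBl scalerA mulVf //.
  by rewrite scale1r.
have gL : linear g.
  move=> a u v; apply: g_uniq; have := Msub.2 a _ _ (gM u) (gM v).
  by rewrite scalerDl -[(a *: g u) *: x]scalerA scalerBr opprD addrACA.
exists (to_ldual (mk_linear gL)); split=> [u Uu|] /=; apply: g_uniq.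
  by rewrite scale0r subr0; apply: UM.
by rewrite scale1r subrr; case: Msub.
Qed.

Definition spanned s v :=
  exists a : 'I_(size s) -> k, v = \sum_(i < size s) a i *: s`_i.

Lemma spanned_subspace s : subspace (spanned s).
Proof.
split=> [|a u v [b ->] [c ->]].
  by exists (fun=> 0); rewrite big1 // => i _; rewrite scale0r.
exists (fun i => a * b i + c i); rewrite scaler_sumr -big_split.
by apply: eq_bigr => i _ /=; rewrite scalerDl scalerA.
Qed.

Lemma spanned_cons x s v :
  spanned (x :: s) v -> exists a, spanned s (v - a *: x).
Proof.
case=> b ->; exists (b ord0); exists (fun i => b (lift ord0 i)).
by rewrite big_ord_recl /= addrC addKr.
Qed.

Lemma spanned_mem s v : v \in s -> spanned s v.
Proof.
move=> vs; have lt_i : (index v s < size s)%N by rewrite index_mem.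
exists (fun i => (i == Ordinal lt_i)%:R); rewrite (bigD1 (Ordinal lt_i)) //=.
rewrite eqxx scale1r nth_index // big1 ?addr0 // => i /negPf ->.
by rewrite scale0r.
Qed.

(** Coordinates on the span of [s] can be chosen as linear forms on the whole
    space, even when [s] is not free: a vector [x] that depends on the
    remaining ones gets the zero form, and otherwise a form that is [1] at [x]
    and kills the others reads off the coordinate along [x]. *)
Lemma dual_system s : exists b : 'I_(size s) -> ldual V,
  forall v, spanned s v -> v = \sum_(i < size s) (b i v : k) *: s`_i.
Proof.
elim: s => [|x s [b bE]].
  by exists (fun=> 0) => v [a ->]; rewrite !big_ord0.
have [sx|nsx] := pselect (spanned s x).
  exists (fun i => oapp b 0 (unlift ord0 i)) => v /spanned_cons[a sva].
  rewrite big_ord_recl unlift_none /= scale0r add0r.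
  under eq_bigr do rewrite liftK /=.
  apply: bE; rewrite -[v](subrK (a *: x)) addrC.
  by apply: (spanned_subspace s).2.
have [g [gs gx]] := form_separating_subspace (spanned_subspace s) nsx.
(* [f] composed with the projection along [x] onto the kernel of [g] *)
pose g' (f : ldual V) : ldual V := f - (f x : k) *: g.
exists (fun i => oapp (g' \o b) g (unlift ord0 i)) => v /spanned_cons[a sva].
have gv : g v = a.
  have := gs _ sva; rewrite linearB linearZ /= gx => /eqP.
  rewrite subr_eq0 => /eqP ->.
  exact: mulr1.
rewrite big_ord_recl unlift_none /= gv -[LHS](subrK (a *: x)) addrC.
congr (_ + _); rewrite {1}(bE _ sva).
apply: eq_bigr => i _; rewrite liftK /= linearB linearZ /=; congr (_ *: _).
change (b i v - a * b i x = b i v - b i x * g v :> k).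
by rewrite gv mulrC.
Qed.

End FormSeparation.

(** * Tensor products *)

Section TensorMaps.
Variable k : fieldType.
Implicit Types A B D E U V W : lmodType k.

Definition lift_linear U V W (f : V -> W -> U) (fB : bilinear_for *:%R *:%R f) :
  {linear V ⊗ W -> U} := mk_linear (tens_lift_linear fB).

Lemma lift_linearE U V W (f : V -> W -> U) (fB : bilinear_for *:%R *:%R f) v w :
  lift_linear fB (v ⊗ₜ w) = f v w.
Proof. exact: tens_liftE. Qed.

Lemma tens_map_linear V V' W W' (f : V -> V') (g : W -> W') :
  linear f -> linear g -> linear (tens_map f g).
Proof.
by move=> fL gL; exact: (linearP (tens_map (mk_linear fL) (mk_linear gL))).
Qed.

Lemma tens_map_pure V V' W W' (f : V -> V') (g : W -> W') v w :
  linear f -> linear g -> tens_map f g (v ⊗ₜ w) = f v ⊗ₜ g w.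
Proof. by move=> fL gL; exact: (tens_mapE (mk_linear fL) (mk_linear gL)). Qed.

Lemma tens_contrl_form_linear V W (t : V ⊗ W) :
  linear (fun f : ldual V => tens_contrl f t).
Proof.
apply: (@tens_lift_param k W V W (ldual V)
  (fun f v w => (f v : k) *: w)) => v w a f g.
by rewrite ldualD ldualZ scalerDl -scalerA.
Qed.

Lemma tens_contrr_form_linear V W (t : V ⊗ W) :
  linear (fun f : ldual W => tens_contrr f t).
Proof.
apply: (@tens_lift_param k V V W (ldual W)
  (fun f v w => (f w : k) *: v)) => v w a f g.
by rewrite ldualD ldualZ scalerDl -scalerA.
Qed.

(** The hypotheses [linear g] and [linear h] allow [g] and [h] to be plain
    functions of a tensor, so that the lemma applies to any subterm of a goal
    after generalizing it; most identities below are reduced to pure tensors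
    in this way. *)
Lemma linear_tens_eq U V W (g h : V ⊗ W -> U) : linear g -> linear h ->
  (forall v w, g (v ⊗ₜ w) = h (v ⊗ₜ w)) -> g =1 h.
Proof.
move=> gL hL.
exact: (linear_tens_ext (g := mk_linear gL) (h := mk_linear hL)).
Qed.

Lemma tens_contrl_map V W W' (h : {linear W -> W'}) (f : ldual V) (t : V ⊗ W) :
  tens_contrl f (tens_map idfun h t) = h (tens_contrl f t).
Proof.
elim/tens_ind: t => [|v w t IHt]; first by rewrite !linear0.
by rewrite !linearD /= IHt tens_mapE !tens_contrlE linearZ.
Qed.

Lemma tens_contrr_map V W V' (h : {linear V -> V'}) (f : ldual W) (t : V ⊗ W) :
  tens_contrr f (tens_map h idfun t) = h (tens_contrr f t).
Proof.
elim/tens_ind: t => [|v w t IHt]; first by rewrite !linear0.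
by rewrite !linearD /= IHt tens_mapE !tens_contrrE linearZ.
Qed.

Lemma eq_tens_map V V' W W' (f f' : V -> V') (g g' : W -> W') :
  f =1 f' -> g =1 g' -> tens_map f g =1 tens_map f' g'.
Proof. by move=> /funext -> /funext ->. Qed.

Lemma linear_at_tens V W U (h : {linear V ⊗ W -> U}) v :
  linear (fun w => h (v ⊗ₜ w)).
Proof. by move=> a x y; rewrite linearPr linearP. Qed.

(** Fixing the first factor as a pure tensor turns the diagonal action of
    [D ⊗ E] on [A ⊗ B] into a function of the tensor [u] of [D ⊗ E] alone;
    [u] will be the coproduct of the acting element. *)
Lemma tens_map_mid_pure A B D E V W (h : {linear A ⊗ D -> V})
    (l : {linear B ⊗ E -> W}) (a : A) (b : B) (u : D ⊗ E) :
  tens_map h l (tens_mid ((a ⊗ₜ b) ⊗ₜ u)) =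
  tens_map (fun d => h (a ⊗ₜ d)) (fun e => l (b ⊗ₜ e)) u.
Proof.
move: u; apply: linear_tens_eq => [r u v||d e].
- by rewrite linearPr !linearP.
- by apply: tens_map_linear; apply: linear_at_tens.
- by rewrite tens_midE tens_mapE tens_map_pure //; apply: linear_at_tens.
Qed.

End TensorMaps.

Section TensorSeparation.
Variables (k : fieldType) (V W : lmodType k).

Lemma ldual_ext (u v : V) : (forall f : ldual V, f u = f v) -> u = v.
Proof.
move=> uv; have [b bE] := dual_system [:: u; v].
rewrite [LHS]bE 1?[RHS]bE; last 2 first.
- by apply: spanned_mem; rewrite !inE eqxx orbT.
- by apply: spanned_mem; rewrite !inE eqxx.
by apply: eq_bigr => i _; rewrite uv.
Qed.

(** Writing [t] as a sum of [v_j ⊗ w_j] and expanding the [v_j] in a dual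
    system [b_i] of the family [v] gives [t] as the sum of the
    [v_i ⊗ (b_i ⊗ I)(t)], so the contractions of [t] determine it. *)
Lemma tens_contrl_ext (s t : V ⊗ W) :
  (forall f : ldual V, tens_contrl f s = tens_contrl f t) -> s = t.
Proof.
(* one family for both tensors, so that both are expanded in the same forms *)
pose vs := [seq p.1 | p <- repr s ++ repr t]; have [b bE] := dual_system vs.
pose P u := u = \sum_(i < size vs) vs`_i ⊗ₜ tens_contrl (b i) (u : V ⊗ W).
have expand (u : V ⊗ W) : {subset repr u <= repr s ++ repr t} -> P u.
  move=> sub; rewrite {}/P {1}(tens_sum u).
  transitivity (\sum_(p <- repr u) \sum_(i < size vs)
      vs`_i ⊗ₜ tens_contrl (b i) (p.1 ⊗ₜ p.2)).
    apply: eq_big_seq => p /sub up.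
    rewrite {1}(bE p.1) ?linear_sumlz; last by apply/spanned_mem/map_f.
    by apply: eq_bigr => i _; rewrite tens_contrlE linearZl linearZr.
  rewrite exchange_big; apply: eq_bigr => i _.
  by rewrite [in RHS](tens_sum u) linear_sum linear_sumr.
move=> st; rewrite [LHS]expand 1?[RHS]expand.
- by apply: eq_bigr => i _; rewrite st.
- by move=> p pin; rewrite mem_cat pin ?orbT.
- by move=> p pin; rewrite mem_cat pin ?orbT.
Qed.

End TensorSeparation.

Section TensorFlip.
Variable k : fieldType.
Implicit Types V W : lmodType k.

Definition tens_flip V W : V ⊗ W -> W ⊗ V := tens_lift (fun v w => w ⊗ₜ v).

Lemma tens_flip_bilinear V W :
  bilinear_for *:%R *:%R (fun (v : V) (w : W) => w ⊗ₜ v).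
Proof. by split=> [w|v] a x y /=; rewrite (tens_linearl, tens_linearr). Qed.

HB.instance Definition _ V W := GRing.isLinear.Build k (V ⊗ W) (W ⊗ V) _
  (@tens_flip V W) (tens_lift_linear (@tens_flip_bilinear V W)).

Lemma tens_flipE V W (v : V) (w : W) : tens_flip (v ⊗ₜ w) = w ⊗ₜ v.
Proof. exact: tens_liftE (@tens_flip_bilinear V W) _ _. Qed.

Lemma tens_flipK V W : cancel (@tens_flip V W) (@tens_flip W V).
Proof.
elim/tens_ind=> [|v w t IHt]; first by rewrite !linear0.
by rewrite !linearD /= IHt !tens_flipE.
Qed.

Lemma tens_contrl_flip V W (f : ldual W) (t : V ⊗ W) :
  tens_contrl f (tens_flip t) = tens_contrr f t.
Proof.
elim/tens_ind: t => [|v w t IHt]; first by rewrite !linear0.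
by rewrite !linearD /= IHt tens_flipE tens_contrlE tens_contrrE.
Qed.

Lemma tens_contrr_ext V W (s t : V ⊗ W) :
  (forall f : ldual W, tens_contrr f s = tens_contrr f t) -> s = t.
Proof.
move=> st; apply: (can_inj (@tens_flipK V W)); apply: tens_contrl_ext => f.
by rewrite !tens_contrl_flip.
Qed.

Lemma tens_form_ext V W (s t : V ⊗ W) :
  (forall (f : ldual V) (g : ldual W), tens_form f g s = tens_form f g t) ->
  s = t.
Proof.
move=> st; apply: tens_contrl_ext => f; apply: ldual_ext => g.
by rewrite -!tens_form_contrl st.
Qed.

End TensorFlip.

(** * Forms on a Hopf algebra: transposing product and coproduct *)

Section Transposition.
Variables (k : fieldType) (H : finHopfAlgType k).
Implicit Types (V W : lmodType k) (f g : ldual H).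

Lemma tens_map_formZ V W (v : V) (w : W) (x y : H) (u : ldual H ⊗ ldual H) :
  tens_map (fun f => (f x : k) *: v) (fun g => (g y : k) *: w) u =
  (tens_form (ldual_eval x) (ldual_eval y) u : k) *: (v ⊗ₜ w).
Proof.
have vL : linear (fun f : ldual H => (f x : k) *: v).
  by move=> a f g; rewrite ldualD ldualZ scalerDl -scalerA.
have wL : linear (fun f : ldual H => (f y : k) *: w).
  by move=> a f g; rewrite ldualD ldualZ scalerDl -scalerA.
move: u; apply: linear_tens_eq => [||f g].
- exact: tens_map_linear.
- by move=> a s t; rewrite linearP scalerDl -scalerA.
- by rewrite tens_map_pure // tens_formE linearZl linearZr /= scalerA mulrC.
Qed.

(** Applying [f] to a product in [H] distributes the two halves of the
    coproduct of [f] over the factors: [f(x y) = f_1(x) f_2(y)]. *)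
Lemma tens_contrl_mul V W (s : H ⊗ V) (t : H ⊗ W) f :
  tens_contrl f (tens_map (@tens_mul k H) idfun (tens_mid (s ⊗ₜ t))) =
  tens_map (fun g : ldual H => tens_contrl g s)
           (fun g : ldual H => tens_contrl g t) (comul f).
Proof.
move: s; apply: linear_tens_eq => [a s s'||x v].
- by rewrite linearPl !linearP.
- apply: (@tens_lift_param k _ _ _ (H ⊗ V)
    (fun s f g => tens_contrl f s ⊗ₜ tens_contrl g t)) => g h a s s'.
  by rewrite linearP linearPl.
move: t; apply: linear_tens_eq => [a t t'||y w].
- by rewrite linearPr !linearP.
- apply: (@tens_lift_param k _ _ _ (H ⊗ W)
    (fun t f g => tens_contrl f (x ⊗ₜ v) ⊗ₜ tens_contrl g t)) => g h a t t'.
  by rewrite linearP linearPr.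
rewrite tens_midE tens_mapE tens_contrlE /= tens_mulE.
rewrite -ldual_comulE -tens_map_formZ.
by apply: eq_tens_map => g; rewrite tens_contrlE.
Qed.

Lemma ldual_mul_contrl f g x : (f ∗ g) x = f (tens_contrr g (comul x)).
Proof.
rewrite ldual_mulE; elim/tens_ind: (comul x) => [|y z t IHt].
  by rewrite !linear0.
rewrite !linearD /= IHt; congr (_ + _).
by rewrite tens_formE tens_contrrE linearZ; exact: mulrC.
Qed.

Lemma contrl_mul_assocV V (x : H) (z : H ⊗ H) (v : V) f g :
  tens_contrl g (tens_contrl f (tens_map (@tens_mul k H) idfun
     (tens_assocV (x ⊗ₜ tens_assoc (z ⊗ₜ v))))) =
  (f (x ∗ tens_contrr g z) : k) *: v.
Proof.
move: z; apply: linear_tens_eq => [a s t|a s t|y z].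
- by rewrite linearPl linearP linearPr !linearP.
- by rewrite linearP linearPr linearP scalerDl -scalerA.
rewrite tens_assocE tens_assocVE tens_mapE.
rewrite !(tens_contrlE, tens_contrrE) /= tens_mulE.
rewrite linearZ /= tens_contrlE linearZr linearZ /= scalerA.
by congr (_ *: _); rewrite linearZ.
Qed.

(** For [t = y ⊗ v] the left side is [f(x y_1) g(y_2) v]; splitting [f] along
    the product and multiplying its second half by [g] along the coproduct of
    [y] gives [f_1(x) (f_2 ∗ g)(y) v]. *)
Lemma contrl_iterated_comul V (x : H) (t : H ⊗ V) f g :
  tens_contrl g (tens_contrl f (tens_map (@tens_mul k H) idfun
     (tens_assocV (x ⊗ₜ tens_assoc (tens_map comul idfun t))))) =
  tens_contrl (ldual_eval x)
    (tens_map idfun (fun h : ldual H => tens_contrl (h ∗ g) t) (comul f)).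
Proof.
move: t; apply: linear_tens_eq => [a s t|a s t|y v].
- by rewrite linearP linearP linearPr !linearP.
- rewrite -linearP /=; congr (tens_contrl _ _).
  apply: (@tens_lift_param k _ _ _ (H ⊗ V)
    (fun t f h => f ⊗ₜ tens_contrl (h ∗ g) t)) => f1 h b t1 t2.
  by rewrite linearP linearPr.
rewrite tens_mapE contrl_mul_assocV -ldual_comulE -[ldual_comul f]/(comul f).
transitivity (tens_contrl (ldual_eval x) (tens_map idfun
    (fun h : ldual H => (h (tens_contrr g (comul y)) : k) *: v) (comul f))).
  have hL : linear (fun h : ldual H => (h (tens_contrr g (comul y)) : k) *: v).
    by move=> a h1 h2; rewrite ldualD ldualZ scalerDl -scalerA.
  move: (comul f); apply: linear_tens_eq => [a s t|a s t|f1 f2].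
  - by rewrite linearP scalerDl -scalerA.
  - by rewrite tens_map_linear // linearP.
  by rewrite tens_map_pure // tens_contrlE tens_formE scalerA.
congr (tens_contrl _ _); apply: eq_tens_map => // h; rewrite tens_contrlE.
congr (_ *: _); exact/esym/ldual_mul_contrl.
Qed.

End Transposition.

(** * Coactions and actions on a coalgebra *)

Section ComoduleCoalgebras.
Variables (k : fieldType) (H : finHopfAlgType k) (C : coalgType k).
Variables (lambda : {linear C -> H ⊗ C}) (ract : {linear C ⊗ ldual H -> C}).
Implicit Types (f g : ldual H) (c : C).
Hypothesis ractE : forall f c, ract (c ⊗ₜ f) = tens_contrl f (lambda c).

(** Why the two compatibilities with Δ are equivalent: [f] splits along the
    product in [f(c_1^- c_2^-) c_1^0 ⊗ c_2^0]. *)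
Lemma coaction_comul c f :
  tens_contrl f (tens_map (@tens_mul k H) idfun
    (tens_mid (tens_map lambda lambda (comul c)))) =
  tens_map ract ract (tens_mid (comul c ⊗ₜ comul f)).
Proof.
move: (comul c); apply: linear_tens_eq => [a x y|a x y|d e].
- by rewrite !linearP.
- by rewrite linearPl !linearP.
rewrite tens_mapE tens_contrl_mul tens_map_mid_pure.
by apply: eq_tens_map => g; rewrite ractE.
Qed.

Lemma contrr_coaction (e : {linear C -> k^o}) c f :
  (e (ract (c ⊗ₜ f)) : k) = f (tens_contrr e (lambda c)).
Proof.
rewrite ractE; elim/tens_ind: (lambda c) => [|h d t IHt].
  by rewrite !linear0.
rewrite !linearD /= IHt; congr (_ + _).
by rewrite tens_contrlE tens_contrrE !linearZ; exact: mulrC.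
Qed.

(** Why the two associativity axioms are equivalent: in
    [f(ε(c_1^0) c_1^- c_2^-_1) g(c_2^-_2) c_2^0] the form [f] splits along the
    product, and its second half is multiplied by [g] along the coproduct of
    [c_2^-]; this gives [ε(c_1 ↼ f_1) (c_2 ↼ f_2 g)]. *)
Lemma coaction_coact c f g :
  tens_contrl g (tens_contrl f (tens_map (@tens_mul k H) idfun (tens_assocV
    (tens_map (tens_contrr (@counit k C) \o lambda)
       (@tens_assoc k H H C \o tens_map (@comul k H) idfun \o lambda)
       (comul c))))) =
  tens_contrl (@counit k C \o ract)
      (tens_map idfun (ract \o tens_map idfun (fun x => x ∗ g))
         (tens_mid (comul c ⊗ₜ comul f))).
Proof.
have gL : linear (fun x : ldual H => x ∗ g) by move=> a x y; rewrite linearPl.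
(* right multiplication by [g] as a bundled linear map, so that the whole
   right side is recognized as linear in its tensors *)
have -> : tens_map (@idfun C) (fun x => x ∗ g) =
    (tens_map idfun (mk_linear gL) : {linear _ -> _})
    :> (C ⊗ ldual H -> C ⊗ ldual H) by [].
move: (comul c); apply: linear_tens_eq => [a s t|a s t|d e].
- by rewrite !linearP.
- by rewrite linearPl !linearP.
rewrite tens_mapE contrl_iterated_comul tens_map_mid_pure.
have hL : linear (fun h : ldual H => tens_contrl (h ∗ g) (lambda e)).
  by move=> a h1 h2; rewrite linearPl tens_contrl_form_linear.
move: (comul f); apply: linear_tens_eq => [a s t|a s t|f1 f2].
- by rewrite tens_map_linear // linearP.
- by rewrite tens_map_linear ?linearP //; apply: linear_at_tens.
rewrite (tens_map_pure f1 f2 _ hL) //.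
rewrite (tens_map_pure f1 f2 (@linear_at_tens _ _ _ _ _ d)
  (@linear_at_tens _ _ _ _ _ e)).
rewrite !tens_contrlE; congr (_ *: _).
  by rewrite -[LHS]contrr_coaction.
by rewrite /= (tens_mapE idfun (mk_linear gL)) ractE.
Qed.

Theorem comodule_module_coalgebra :
  left_partial_comodule_coalgebra lambda <->
  right_partial_module_coalgebra ract.
Proof.
split=> -[ax1 ax2 ax3].
  split=> [c|c f|c f g]; first by rewrite ractE; exact: ax1.
    by rewrite -coaction_comul -ax2 tens_contrl_map ractE.
  by rewrite -coaction_coact -ax3 tens_contrl_map !ractE.
split=> c; first by rewrite -[RHS]ax1 ractE.
  apply: tens_contrl_ext => f.
  by rewrite coaction_comul -ax2 tens_contrl_map ractE.
apply: tens_contrl_ext => f; apply: tens_contrl_ext => g.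
by rewrite coaction_coact -ax3 tens_contrl_map !ractE.
Qed.

End ComoduleCoalgebras.

(** * Actions on a coalgebra and on its dual algebra *)

Section DualAction.
Variables (k : fieldType) (K : hopfAlgType k) (C : coalgType k).
Variables (ract : {linear C ⊗ K -> C}) (lact : {linear K ⊗ ldual C -> ldual C}).
Hypothesis lactE : forall h (alpha : ldual C) c,
  lact (h ⊗ₜ alpha) c = alpha (ract (c ⊗ₜ h)).

(** The product of [C^*] is convolution, so [((h_1 ⇀ α)(h_2 ⇀ β))(c)] is
    [α(c_1 ↼ h_1) β(c_2 ↼ h_2)]. *)
Lemma form_act_comul (alpha beta : ldual C) c h :
  tens_form alpha beta (tens_map ract ract (tens_mid (comul c ⊗ₜ comul h))) =
  tens_mul (tens_map lact lact (tens_mid (comul h ⊗ₜ (alpha ⊗ₜ beta)))) c.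
Proof.
move: (comul h); apply: linear_tens_eq => [a s t|a s t|h1 h2].
- by rewrite linearPr !linearP.
- by rewrite linearPl !linearP.
rewrite [in RHS]tens_midE tens_mapE tens_mulE ldual_mulE.
move: (comul c); apply: linear_tens_eq => [a s t|a s t|d e].
- by rewrite linearPl !linearP.
- by rewrite !linearP.
by rewrite tens_midE tens_mapE !tens_formE /= !lactE.
Qed.

(** The unit of [C^*] is [ε], so [ε(c_1 ↼ h_1) α(c_2 ↼ h_2 g)] is the value
    of [(h_1 ⇀ 1)(h_2 g ⇀ α)] at [c]. *)
Lemma form_act_act (alpha : ldual C) c h g :
  alpha (tens_contrl (@counit k C \o ract)
      (tens_map idfun (ract \o tens_map idfun (fun x => x ∗ g))
         (tens_mid (comul c ⊗ₜ comul h)))) =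
  tens_mul (tens_map (fun x => lact (x ⊗ₜ 𝟙)) (fun x => lact ((x ∗ g) ⊗ₜ alpha))
      (comul h)) c.
Proof.
have gL : linear (fun x : K => x ∗ g) by move=> a x y; rewrite linearPl.
have -> : tens_map (@idfun C) (fun x => x ∗ g) =
    (tens_map idfun (mk_linear gL) : {linear _ -> _}) :> (C ⊗ K -> C ⊗ K) by [].
have l1L : linear (fun x => lact (x ⊗ₜ 𝟙)).
  by move=> a x y; rewrite linearPl linearP.
have lgL : linear (fun x => lact ((x ∗ g) ⊗ₜ alpha)).
  by move=> a x y; rewrite linearPl linearPl linearP.
move: (comul h); apply: linear_tens_eq => [a s t|a s t|h1 h2].
- by rewrite linearPr !linearP.
- by rewrite tens_map_linear // !linearP.
rewrite tens_map_pure // tens_mulE ldual_mulE.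
move: (comul c); apply: linear_tens_eq => [a s t|a s t|d e].
- by rewrite linearPl !linearP.
- by rewrite !linearP.
rewrite tens_midE tens_mapE tens_contrlE linearZ tens_formE /= !lactE.
by rewrite (tens_mapE idfun (mk_linear gL)).
Qed.

Theorem module_coalgebra_dual :
  right_partial_module_coalgebra ract <-> left_partial_module_algebra lact.
Proof.
split=> -[ax1 ax2 ax3].
  split=> [alpha|h alpha beta|h g alpha]; apply: ldualP => c.
  - by rewrite lactE ax1.
  - by rewrite lactE ldual_mulE ax2 form_act_comul.
  - by rewrite !lactE ax3 form_act_act.
split=> [c|c h|c h g]; [apply: ldual_ext => alpha| |apply: ldual_ext => alpha].
- by rewrite -lactE ax1.
- apply: tens_form_ext => alpha beta.
  by rewrite form_act_comul -ax2 lactE ldual_mulE.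
- by rewrite form_act_act -ax3 !lactE.
Qed.

End DualAction.

(** * Coactions and actions on an algebra *)

Section ComoduleAlgebras.
Variables (k : fieldType) (H : finHopfAlgType k) (A : unitalAlgType k).
Implicit Types (f g : ldual H) (s t : A ⊗ H).

(** The same transposition in [A ⊗ H], where the remaining factors are also
    multiplied: [f(x y) (a b) = (f_1(x) a)(f_2(y) b)]. *)
Lemma tens_contrr_mul s t f :
  tens_contrr f (s ∗ t) = tens_mul (tens_map
    (fun g : ldual H => tens_contrr g s)
    (fun g : ldual H => tens_contrr g t) (comul f)).
Proof.
move: s; apply: linear_tens_eq => [r s s'||a x].
- by rewrite linearPl linearP.
- move=> r s s'; rewrite -linearP; congr (tens_mul _).
  apply: (@tens_lift_param k _ _ _ (A ⊗ H)
    (fun s f g => tens_contrr f s ⊗ₜ tens_contrr g t)) => g h b s1 s2.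
  by rewrite linearP linearPl.
move: t; apply: linear_tens_eq => [r t t'||b y].
- by rewrite linearPr linearP.
- move=> r t t'; rewrite -linearP; congr (tens_mul _).
  apply: (@tens_lift_param k _ _ _ (A ⊗ H)
    (fun t f g => tens_contrr f (a ⊗ₜ x) ⊗ₜ tens_contrr g t)) => g h c t1 t2.
  by rewrite linearP linearPr.
transitivity (tens_mul (tens_map (fun f : ldual H => (f x : k) *: a)
  (fun f : ldual H => (f y : k) *: b) (comul f))).
  rewrite tens_map_formZ linearZ /= tens_mulE mul_tens tens_contrrE.
  by congr (_ *: _); exact/esym/ldual_comulE.
by congr (tens_mul _); apply: eq_tens_map => g; rewrite tens_contrrE.
Qed.

(** The last [H] factor comes only from the coproduct, as the other factor of
    the product has unit there; so [g] acts on [s] alone. *)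
Lemma contrr_coact_mul s t g :
  tens_contrr g ((t ⊗ₜ 𝟙) ∗ tens_assocV (tens_map idfun (@comul k H) s)) =
  t ∗ tens_map idfun (tens_contrr g \o @comul k H) s.
Proof.
move: s; apply: linear_tens_eq => [r s s'|r s s'|b y].
- by rewrite linearP linearP linearPr linearP.
- by rewrite linearP linearPr.
rewrite !tens_mapE /=; move: (comul y).
apply: linear_tens_eq => [r z z'|r z z'|y1 y2].
- by rewrite linearPr linearP linearPr linearP.
- by rewrite linearP linearPr linearPr.
by rewrite tens_assocVE mul_tens amul1l !tens_contrrE linearZr linearZr.
Qed.

Lemma contrr_translate s f g :
  tens_contrr f (tens_map idfun (tens_contrr g \o @comul k H) s) =
  tens_contrr (f ∗ g) s.
Proof.
move: s; apply: linear_tens_eq => [r s s'|r s s'|b y]; try by rewrite !linearP.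
by rewrite tens_mapE !tens_contrrE; congr (_ *: _); exact/esym/ldual_mul_contrl.
Qed.

Variables (rho : {linear A -> A ⊗ H}) (lact : {linear ldual H ⊗ A -> A}).
Hypothesis lactE : forall f a, lact (f ⊗ₜ a) = tens_contrr f (rho a).

Lemma contrr_coaction_mul a b f :
  tens_contrr f (rho a ∗ rho b) =
  tens_mul (tens_map lact lact (tens_mid (comul f ⊗ₜ (a ⊗ₜ b)))).
Proof.
rewrite tens_contrr_mul; move: (comul f).
have L c : linear (fun g : ldual H => tens_contrr g (rho c)).
  exact: tens_contrr_form_linear.
apply: linear_tens_eq => [r u v|r u v|f1 f2].
- by rewrite tens_map_linear // linearP.
- by rewrite linearPl !linearP.
by rewrite tens_map_pure // tens_midE tens_mapE !lactE.
Qed.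

Lemma contrr_coaction_coact a f g :
  tens_contrr f (tens_contrr g
    ((rho 𝟙 ⊗ₜ 𝟙) ∗ tens_assocV (tens_map idfun (@comul k H) (rho a)))) =
  tens_mul (tens_map (fun x => lact (x ⊗ₜ 𝟙)) (fun x => lact ((x ∗ g) ⊗ₜ a))
      (comul f)).
Proof.
rewrite contrr_coact_mul tens_contrr_mul; congr (tens_mul _).
by apply: eq_tens_map => h; rewrite lactE // contrr_translate.
Qed.

Theorem comodule_module_algebra :
  right_partial_comodule_algebra rho <-> left_partial_module_algebra lact.
Proof.
split=> -[ax1 ax2 ax3].
  split=> [a|f a b|f g a]; first by rewrite lactE; exact: ax1.
    by rewrite lactE ax2 contrr_coaction_mul.
  by rewrite -contrr_coaction_coact -ax3 tens_contrr_map !lactE.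
split=> [a|a b|a]; first by rewrite -[RHS]ax1 lactE.
  apply: tens_contrr_ext => f.
  by rewrite contrr_coaction_mul -ax2 lactE.
apply: tens_contrr_ext => g; apply: tens_contrr_ext => f.
by rewrite contrr_coaction_coact -ax3 tens_contrr_map !lactE.
Qed.

End ComoduleAlgebras.

(** * Existence of corresponding structure maps *)

Section Existence.
Variables (k : fieldType) (H : finHopfAlgType k).
Implicit Types V A : lmodType k.

Local Notation e i := ((vbasis {:H})`_i).

Lemma action_of_left_coaction V (lambda : {linear V -> H ⊗ V}) :
  exists ract : {linear V ⊗ ldual H -> V},
    forall f v, ract (v ⊗ₜ f) = tens_contrl f (lambda v).
Proof.
have B : bilinear_for *:%R *:%R
    (fun v (f : ldual H) => tens_contrl f (lambda v)).
  by split=> [f|v] a x y /=; rewrite ?linearP // tens_contrl_form_linear.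
by exists (lift_linear B) => f v; rewrite lift_linearE.
Qed.

Lemma action_of_right_coaction A (rho : {linear A -> A ⊗ H}) :
  exists lact : {linear ldual H ⊗ A -> A},
    forall f a, lact (f ⊗ₜ a) = tens_contrr f (rho a).
Proof.
have B : bilinear_for *:%R *:%R (fun (f : ldual H) a => tens_contrr f (rho a)).
  by split=> [a|f] r x y /=; rewrite ?linearP // tens_contrr_form_linear.
by exists (lift_linear B) => f a; rewrite lift_linearE.
Qed.

(** The witness is the sum of the [e_i ⊗ (v ↼ e^i)] over dual bases of [H]. *)
Lemma left_coaction_of_action V (ract : {linear V ⊗ ldual H -> V}) :
  exists lambda : {linear V -> H ⊗ V},
    forall f v, ract (v ⊗ₜ f) = tens_contrl f (lambda v).
Proof.
have L : linear (fun v => \sum_(i < \dim {:H}) e i ⊗ₜ ract (v ⊗ₜ dual_basis i)).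
  move=> a v w; rewrite scaler_sumr -big_split; apply: eq_bigr => i _.
  by rewrite linearPl linearP linearPr.
exists (mk_linear L) => f v; rewrite /= linear_sum {1}(ldual_expand f).
rewrite linear_sumr linear_sum; apply: eq_bigr => i _.
by rewrite /= tens_contrlE linearZr linearZ.
Qed.

Lemma right_coaction_of_action A (lact : {linear ldual H ⊗ A -> A}) :
  exists rho : {linear A -> A ⊗ H},
    forall f a, lact (f ⊗ₜ a) = tens_contrr f (rho a).
Proof.
have L : linear (fun a => \sum_(i < \dim {:H}) lact (dual_basis i ⊗ₜ a) ⊗ₜ e i).
  move=> r a b; rewrite scaler_sumr -big_split; apply: eq_bigr => i _.
  by rewrite linearPr linearP linearPl.
exists (mk_linear L) => f a; rewrite /= linear_sum {1}(ldual_expand f).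
rewrite linear_sumlz linear_sum; apply: eq_bigr => i _.
by rewrite /= tens_contrrE linearZl linearZ.
Qed.

Lemma transpose_action (K V : lmodType k) (ract : {linear V ⊗ K -> V}) :
  exists lact : {linear K ⊗ ldual V -> ldual V},
    forall h (alpha : ldual V) v, lact (h ⊗ₜ alpha) v = alpha (ract (v ⊗ₜ h)).
Proof.
have rL h : linear (fun v => ract (v ⊗ₜ h)).
  by move=> a v w; rewrite linearPl linearP.
pose act h (alpha : ldual V) := to_ldual (alpha \o mk_linear (rL h)).
have B : bilinear_for *:%R *:%R act.
  by split=> [alpha|h] a x y; apply: ldualP => v //=; rewrite linearPr !linearP.
by exists (lift_linear B) => h alpha v; rewrite lift_linearE.
Qed.

(** With a dual system [b_i] of a spanning family [s_i] of [V], the witness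
    sends [v ⊗ h] to the sum of the [(h ⇀ b_i)(v) s_i]: the [b_i] span [V^*],
    so a form on [V^*] is the evaluation at a vector of [V]. *)
Lemma untranspose_action (K V : lmodType k)
    (lact : {linear K ⊗ ldual V -> ldual V}) :
  finite_dimensional V ->
  exists ract : {linear V ⊗ K -> V},
    forall h (alpha : ldual V) v, lact (h ⊗ₜ alpha) v = alpha (ract (v ⊗ₜ h)).
Proof.
case=> s sV; have [b bE] := dual_system s.
have alphaE (alpha : ldual V) :
    alpha = \sum_(i < size s) (alpha s`_i : k) *: b i.
  apply: ldualP => v; rewrite {1}(bE _ (sV v)) linear_sum ldual_sum.
  by apply: eq_bigr => i _; rewrite linearZ; exact: mulrC.
have B : bilinear_for *:%R *:%R
    (fun v (h : K) => \sum_(i < size s) (lact (h ⊗ₜ b i) v : k) *: s`_i).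
  split=> [h|v] a x y /=; rewrite scaler_sumr -big_split; apply: eq_bigr => i _.
    by rewrite linearP scalerDl -scalerA.
  by rewrite linearPl linearP ldualD ldualZ scalerDl -scalerA.
exists (lift_linear B) => h alpha v; rewrite lift_linearE {1}(alphaE alpha).
rewrite linear_sumr !linear_sum ldual_sum; apply: eq_bigr => i _.
by rewrite linearZr [RHS]linearZ linearZ; exact: mulrC.
Qed.

Variables (C : coalgType k) (lambda : {linear C -> H ⊗ C}).
Variables (rho : {linear ldual C -> ldual C ⊗ H}).
Variables (ract : {linear C ⊗ ldual H -> C}).
Variables (lact : {linear ldual H ⊗ ldual C -> ldual C}).

(** The relation between the two coactions follows from the others: both sides
    lie in [H], and a form [f] of [H^*] takes the value [(f ⇀ α)(c)] on each. *)
Lemma correspondingP :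
  (forall f (alpha : ldual C) c, lact (f ⊗ₜ alpha) c = alpha (ract (c ⊗ₜ f))) ->
  (forall f c, ract (c ⊗ₜ f) = tens_contrl f (lambda c)) ->
  lact_of_rho rho lact -> corresponding lambda rho ract lact.
Proof.
move=> lr rl lrho; split=> // alpha c; apply: ldual_ext => f.
transitivity (lact (f ⊗ₜ alpha) c : k).
  by rewrite lr; exact/esym/(contrr_coaction rl).
rewrite lrho.
move: (rho alpha); apply: (@linear_tens_eq k k^o) => [a s t|a s t|beta h].
- by rewrite linearP.
- by rewrite !linearP.
by rewrite tens_contrrE tens_contrlE linearZ; exact: mulrC.
Qed.

End Existence.

Theorem theorem4p17 (k : fieldType) (H : finHopfAlgType k) (C : coalgType k) :
  [/\ (* the four statements are equivalent for corresponding structure maps *)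
      forall (lambda : {linear C -> H ⊗ C})
             (rho : {linear ldual C -> ldual C ⊗ H})
             (ract : {linear C ⊗ ldual H -> C})
             (lact : {linear ldual H ⊗ ldual C -> ldual C}),
        corresponding lambda rho ract lact ->
        [<-> left_partial_comodule_coalgebra lambda;
             right_partial_comodule_algebra rho;
             right_partial_module_coalgebra ract;
             left_partial_module_algebra lact],
      (* every structure map on C has corresponding maps *)
      forall lambda : {linear C -> H ⊗ C},
        exists rho ract lact, corresponding lambda rho ract lact,
      forall ract : {linear C ⊗ ldual H -> C},
        exists lambda rho lact, corresponding lambda rho ract lact
    & [/\ (* on C^*, coactions of H and actions of H^* correspond *)
          forall rho : {linear ldual C -> ldual C ⊗ H},
            exists lact, lact_of_rho rho lact,
          forall lact : {linear ldual H ⊗ ldual C -> ldual C},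
            exists rho, lact_of_rho rho lact,
          forall (rho : {linear ldual C -> ldual C ⊗ H})
                 (lact : {linear ldual H ⊗ ldual C -> ldual C}),
            lact_of_rho rho lact ->
            (right_partial_comodule_algebra rho <->
             left_partial_module_algebra lact)
        & (* and every structure map on C^* comes from C when dim C is finite *)
          finite_dimensional C ->
          forall rho : {linear ldual C -> ldual C ⊗ H},
            exists lambda ract lact, corresponding lambda rho ract lact]].
Proof.
split=> [lambda rho ract lact [_ lr rl lrho]|lambda|ract|].
- have comod_mod := comodule_module_coalgebra rl.
  have mod_dual := module_coalgebra_dual lr.
  have comod_alg := comodule_module_algebra lrho.
  by tfae; tauto.
- have [ract rl] := action_of_left_coaction lambda.
  have [lact lr] := transpose_action ract.
  have [rho lrho] := right_coaction_of_action lact.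
  by exists rho, ract, lact; apply: correspondingP.
- have [lambda rl] := left_coaction_of_action ract.
  have [lact lr] := transpose_action ract.
  have [rho lrho] := right_coaction_of_action lact.
  by exists lambda, rho, lact; apply: correspondingP.
split=> [rho|lact|rho lact|fdC rho].
- exact: action_of_right_coaction.
- exact: right_coaction_of_action.
- exact: comodule_module_algebra.
have [lact lrho] := action_of_right_coaction rho.
have [ract lr] := untranspose_action lact fdC.
have [lambda rl] := left_coaction_of_action ract.
by exists lambda, ract, lact; apply: correspondingP.
Qed.
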